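(* Let $\omega\in\mathcal W=\bigcup_{\alpha>-n}\mathcal W_\alpha$. Let $\psi:[0,1]\to[0,\infty)$ be measurable and let $s:[0,1]\to\mathbb R$ be a measurable function such that $s(t)\ne0$ for almost every $t\in[0,1]$. (i) If $\int_0^1\psi(t)\,dt<\infty$, then $U_{\psi,s}:BMO(\omega)\to BMO(\omega)$ exists as a bounded operator and $$\|U_{\psi,s}\|_{BMO(\omega)\to BMO(\omega)}\le\int_0^1\psi(t)\,dt.$$ (ii) If $n=1$ and $U_{\psi,s}:BMO(\omega)\to BMO(\omega)$ exists as a bounded operator, then $$\left|\int_0^1\operatorname{sgn}s(t)\cdot\psi(t)\,dt\right|<\infty.$$ Moreover, if $s(t)$ does not change sign on $[0,1]$, then the operator norm of $U_{\psi,s}$ on $BMO(\omega)$ is given by $$\|U_{\psi,s}\|_{BMO(\omega)\to BMO(\omega)}=\int_0^1\psi(t)\,dt.$$ (iii) If $n>1$, then $U_{\psi,s}:BMO(\omega)\to BMO(\omega)$ exists as a bounded operator if and only if $\int_0^1\psi(t)\,dt<\infty$. Moreover, the operator norm of $U_{\psi,s}$ on $BMO(\omega)$ is also given by $$\|U_{\psi,s}\|_{BMO(\omega)\to BMO(\omega)}=\int_0^1\psi(t)\,dt.$$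
   Context: Fix an integer $n\ge 1$. $S_n=\{x\in\mathbb R^n:|x|=1\}$ with surface measure $\sigma$; when $n=1$, $\int_{S_n}\omega\,d\sigma$ means $2\omega(1)$. For $\alpha\in\mathbb R$, $\mathcal W_\alpha$ is the set of all measurable functions $\omega$ on $\mathbb R^n$ with $\omega(x)>0$ for a.e. $x$, $0<\int_{S_n}\omega(y)\,d\sigma(y)<\infty$, and $\omega(tx)=|t|^\alpha\omega(x)$ for all $t\in\mathbb R\setminus\{0\}$, $x\in\mathbb R^n$. For measurable $\psi:[0,1]\to[0,\infty)$ and $s:[0,1]\to\mathbb R$, the generalized Hardy-Cesàro operator is $U_{\psi,s}f(x)=\int_0^1 f(s(t)x)\psi(t)\,dt$ for measurable complex-valued $f$ on $\mathbb R^n$. $BMO(\omega)$ is the space of functions $f$ with $$\|f\|_{BMO(\omega)}=\sup_B\frac1{\omega(B)}\int_B|f(x)-f_{B,\omega}|\,\omega(x)\,dx<\infty,$$ where the supremum is over all $n$-dimensional balls $B$, $\omega(B)=\int_B\omega(x)\,dx$ and $f_{B,\omega}=\frac1{\omega(B)}\int_Bf(x)\omega(x)\,dx$. Operator norms on $BMO(\omega)$ are taken with respect to this seminorm.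
   Formalization: Where the integral defining U f diverges, U f is taken modulo constants, as the integral of (f(s(t)x)-c(t))ψ(t) for suitable c(t); pointwise, (i) and sufficiency in (iii) fail, e.g. n=1, ω=ψ=1, s(t)=exp(-1/t), f=log|x|. *)

(* Defs.v *)
From HB Require Import structures.
From mathcomp Require Import all_boot all_order all_algebra.
From mathcomp Require Import all_classical all_reals all_analysis.
From mathcomp Require Import measurable_realfun.
From mathcomp.real_closed Require Import complex.

Set Implicit Arguments.
Unset Strict Implicit.
Unset Printing Implicit Defensive.

Import Order.TTheory GRing.Theory Num.Theory.
Import numFieldNormedType.Exports.

Local Open Scope classical_set_scope.
Local Open Scope ring_scope.
Local Open Scope complex_scope.

Section euclidean_space.
Context (R : realType) (n : nat).

Definition scalev (t : R) (x : n.-tuple R) : n.-tuple R :=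
  [tuple t * tnth x i | i < n].

Definition subv (x y : n.-tuple R) : n.-tuple R :=
  [tuple tnth x i - tnth y i | i < n].

Definition normv (x : n.-tuple R) : R := Num.sqrt (\sum_(i < n) tnth x i ^+ 2).

Definition ballv (c : n.-tuple R) (r : R) : set (n.-tuple R) :=
  [set x | normv (subv x c) < r].

Definition spherev : set (n.-tuple R) := [set x | normv x = 1].

Definition normalizev (x : n.-tuple R) : n.-tuple R := scalev (normv x)^-1 x.

Lemma measurable_normv : measurable_fun [set: n.-tuple R] normv.
Proof.
apply: measurableT_comp.
  by apply: continuous_measurable_fun => x; exact: sqrt_continuous.
apply: measurable_sum => i; apply: measurable_funX.
exact: measurable_tnth.
Qed.

End euclidean_space.

Section lebesgue_measure_Rn.
Context (R : realType).

Definition consv n (p : n.-tuple R * R) : n.+1.-tuple R :=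
  [the n.+1.-tuple R of p.2 :: p.1].

Lemma measurable_consv n :
  measurable_fun [set: n.-tuple (measurableTypeR R) * measurableTypeR R]
    (@consv n : _ -> n.+1.-tuple (measurableTypeR R)).
Proof.
exact: (@measurable_cons _ _ _ _ snd n fst measurable_snd measurable_fst).
Qed.

Fixpoint borel_lebesgue n : set (n.-tuple (measurableTypeR R)) -> \bar R :=
  match n with
  | 0 => \d_ [tuple]
  | m.+1 => pushforward (@borel_lebesgue m \x lebesgue_measure)%E (@consv m)
  end.

Lemma borel_lebesgue_measureP n :
  {m : {measure set (n.-tuple (measurableTypeR R)) -> \bar R} |
    m = @borel_lebesgue n :> (_ -> _)}.
Proof.
elim: n => [|n [m mE]]; first by exists \d_ [tuple].
exists (measure_function_pushforward__canonical__measure_function_Measure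
  (m \x lebesgue_measure)%E (@measurable_consv n)).
by rewrite /= mE.
Qed.

Section borel_lebesgue_measure.
Variable n : nat.
Local Notation mu := (@borel_lebesgue n).

Let mu0 : mu set0 = 0%E.
Proof. by have [m <-] := borel_lebesgue_measureP n; exact: measure0. Qed.

Let mu_ge0 A : (0 <= mu A)%E.
Proof. by have [m <-] := borel_lebesgue_measureP n; exact: measure_ge0. Qed.

Let mu_sigma_additive : semi_sigma_additive mu.
Proof.
have [m <-] := borel_lebesgue_measureP n.
exact: measure_semi_sigma_additive.
Qed.

HB.instance Definition _ :=
  isMeasure.Build _ _ _ mu mu0 mu_ge0 mu_sigma_additive.

End borel_lebesgue_measure.

(* R with the sigma-algebra of Lebesgue measurable sets *)
Definition R1 : measurableType _ := caratheodory_type ((@wlength R idfun)^*)%mu.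

(* R^n with the sigma-algebra of Lebesgue measurable sets *)
Definition Rn n : measurableType _ :=
  caratheodory_type ((@borel_lebesgue n)^*)%mu.

Definition lebesgue_Rn n : set (Rn n) -> \bar R :=
  @completed_measure_extension _ _ _ (@borel_lebesgue n).
HB.instance Definition _ n := Measure.on (@lebesgue_Rn n).

End lebesgue_measure_Rn.
Arguments lebesgue_Rn R n : clear implicits.

Section surface_measure.
Context (R : realType) (n : nat).

Lemma measurable_normv_Rn : measurable_fun [set: Rn R n] (@normv R n).
Proof.
move=> _ A mA; apply: sub_caratheodory; apply: sub_sigma_algebra.
exact: measurable_normv.
Qed.

Definition punctured_ballv : set (Rn R n) := [set x | 0 < normv x < 1].

Lemma measurable_punctured_ballv : measurable punctured_ballv.
Proof.
rewrite (_ : punctured_ballv = [set: Rn R n] `&` (@normv R n) @^-1` `]0, 1[).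
  by apply: measurable_normv_Rn.
by rewrite setTI; apply/seteqP; split=> x /=; rewrite in_itv.
Qed.

(* A subset of the unit sphere is measurable when the cone over it is
   Lebesgue measurable, and its measure is n times that of the part of the cone
   lying in the unit ball. For n = 1 both points of the sphere get measure 1. *)
Definition sphere_space : measurableType _ :=
  g_sigma_algebraType
    (image_set_system setT (@normalizev R n) (@measurable _ (Rn R n))).

Definition surface_measure (A : set sphere_space) : \bar R :=
  (n%:R%:E * lebesgue_Rn R n (punctured_ballv `&` (@normalizev R n) @^-1` A))%E.

Lemma measurable_normalizev :
  measurable_fun [set: Rn R n] (@normalizev R n : Rn R n -> sphere_space).
Proof.
move=> _ A mA.
have E := sigma_algebra_id (@sigma_algebra_image _ _ setT (@normalizev R n) _
  (sigma_algebra_measurable (Rn R n))).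
change (image_set_system setT (@normalizev R n) (@measurable _ (Rn R n)) A).
by rewrite -E.
Qed.

Let surface_measureE : surface_measure =
  mscale (n%:R%:nng : {nonneg R})
    (measure_function_pushforward__canonical__measure_function_Measure
      (mrestr (lebesgue_Rn R n) measurable_punctured_ballv)
      measurable_normalizev).
Proof. by apply/funext => A; rewrite /surface_measure setIC. Qed.

Let surface_measure0 : surface_measure set0 = 0%E.
Proof. by rewrite surface_measureE measure0. Qed.

Let surface_measure_ge0 A : (0 <= surface_measure A)%E.
Proof. by rewrite surface_measureE measure_ge0. Qed.

Let surface_measure_sigma_additive : semi_sigma_additive surface_measure.
Proof. by rewrite surface_measureE; exact: measure_semi_sigma_additive. Qed.

HB.instance Definition _ := isMeasure.Build _ _ _ surface_measure
  surface_measure0 surface_measure_ge0 surface_measure_sigma_additive.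

End surface_measure.
Arguments surface_measure R n : clear implicits.

Section complex_integral.
Context d (T : measurableType d) (R : realType).
Implicit Types (mu : {measure set T -> \bar R}) (D : set T) (f : T -> R[i]).

Definition cmeasurable_fun D f : Prop :=
  measurable_fun D (fun x => complex.Re (f x)) /\
  measurable_fun D (fun x => complex.Im (f x)).

Definition cintegrable mu D f : Prop :=
  mu.-integrable D (fun x => (complex.Re (f x))%:E) /\
  mu.-integrable D (fun x => (complex.Im (f x))%:E).

Definition cintegral mu D f : R[i] :=
  (\int[mu]_(x in D) complex.Re (f x)) +i*
  (\int[mu]_(x in D) complex.Im (f x)).

End complex_integral.

Section weights.
Context (R : realType) (n : nat).
Implicit Type w : n.-tuple R -> R.

Definition weight_class (alpha : R) w : Prop :=
  [/\ measurable_fun [set: Rn R n] w,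
      {ae lebesgue_Rn R n, forall x, 0 < w x},
      (0 < \int[surface_measure R n]_(y in @spherev R n) (w y)%:E < +oo)%E &
      forall (t : R) (x : n.-tuple R),
        t != 0 -> w (scalev t x) = `|t| `^ alpha * w x].

Definition weight w : Prop :=
  exists2 alpha : R, - n%:R < alpha & weight_class alpha w.

End weights.

Section bmo.
Context (R : realType) (n : nat) (w : n.-tuple R -> R).
Implicit Types (f : n.-tuple R -> R[i]) (B : set (n.-tuple R)).

Definition mass B : \bar R := \int[lebesgue_Rn R n]_(x in B) (w x)%:E.

Definition weighted_mean f B : R[i] :=
  ((fine (mass B))^-1)%:C *
  cintegral (lebesgue_Rn R n) B (fun x => f x * (w x)%:C).

Definition mean_oscillation f B : \bar R :=
  (((fine (mass B))^-1)%:E *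
   \int[lebesgue_Rn R n]_(x in B)
     (Normc.normc (f x - weighted_mean f B) * w x)%:E)%E.

Definition bmo_norm f : \bar R :=
  ereal_sup [set e | exists (c : n.-tuple R) (r : R),
    0 < r /\ e = mean_oscillation f (ballv c r)].

Definition bmo f : Prop :=
  [/\ cmeasurable_fun [set: Rn R n] f,
      forall (c : n.-tuple R) (r : R), 0 < r ->
        cintegrable (lebesgue_Rn R n) (ballv c r) (fun x => f x * (w x)%:C) &
      (bmo_norm f < +oo)%E].

End bmo.

Section hardy_cesaro.
Context (R : realType) (n : nat) (psi s : R -> R).
Implicit Types f g : n.-tuple R -> R[i].
Local Notation mu := (@completed_lebesgue_measure R).

Definition hardy_cesaro f (x : n.-tuple R) : R[i] :=
  cintegral mu `[0, 1] (fun t => f (scalev (s t) x) * (psi t)%:C).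

Definition hardy_cesaro_converges f : Prop :=
  {ae lebesgue_Rn R n, forall x,
    cintegrable mu `[0, 1] (fun t => f (scalev (s t) x) * (psi t)%:C)}.

(* [hardy_cesaro_image f g] says that g is the image of f, up to null sets and
   constants. Elements of BMO are functions modulo constants, hence so are the
   dilates x |-> f (s t x), which may be represented by f (s t x) - c t.
   Two choices of c change the integral by a constant, which the seminorm does
   not see, and g is the integral of f (s t x) itself whenever that converges.
   It need not converge on all of BMO, even for integrable psi: in dimension 1,
   for w = 1, psi = 1, s t = exp (- 1 / t) and f x = ln |x|, it diverges at
   every x. *)
Definition hardy_cesaro_image f g : Prop :=
  (hardy_cesaro_converges f ->
    {ae lebesgue_Rn R n, forall x, g x = hardy_cesaro f x}) /\
  exists c : R -> R[i], {ae lebesgue_Rn R n, forall x,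
    let F t := (f (scalev (s t) x) - c t) * (psi t)%:C in
    cintegrable mu `[0, 1] F /\ g x = cintegral mu `[0, 1] F}.

Definition hardy_cesaro_bound (w : n.-tuple R -> R) (C : R) : Prop :=
  0 <= C /\
  forall f, bmo w f ->
    (exists g, hardy_cesaro_image f g) /\
    (forall g, hardy_cesaro_image f g ->
      bmo w g /\ (bmo_norm w g <= C%:E * bmo_norm w f)%E).

Definition hardy_cesaro_bounded (w : n.-tuple R -> R) : Prop :=
  exists C, hardy_cesaro_bound w C.

(* the value is +oo when the operator is not bounded *)
Definition hardy_cesaro_norm (w : n.-tuple R -> R) : \bar R :=
  ereal_inf [set C%:E | C in hardy_cesaro_bound w].

End hardy_cesaro.

(* Main.v *)
From HB Require Import structures.
Require Import Defs.
From mathcomp Require Import all_boot all_order all_algebra.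
From mathcomp Require Import all_classical all_reals all_analysis.
From mathcomp Require Import measurable_realfun.
From mathcomp.real_closed Require Import complex.
From mathcomp Require Import ring lra.

(** The weight is homogeneous, so replacing x by s x multiplies the mass of a
    set and every weighted integral by one factor, which cancels in means and
    mean oscillations: the oscillation of the dilate f (s x) on a ball is that
    of f on the dilated ball, and all dilates of f have the seminorm of f.

    Upper bound. Fix a ball B and subtract from each dilate its weighted mean on
    B. The averages of these deviations with density psi still have mean zero on
    B, by Fubini's theorem, and their oscillation is at most the integral of psi
    times the seminorm of f, by Minkowski's inequality for integrals
    ([integral_dilate_dev_int_le]). Every image g of f differs from this average
    by a constant on B ([image_mod_constant]): at a point where both integrals
    converge, the difference of the subtracted constants is integrable in t.
    Hence g inherits the bound on every ball ([image_bmo]). Fubini's theorem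
    asks for joint measurability of f (s t x), which a Lebesgue measurable f does
    not provide; f is therefore replaced by a Borel function equal to it off a
    Borel null set N, and for almost every x the point s t x avoids N for almost
    every t ([ae_dilate_notin]), so that the images do not change
    ([hardy_cesaro_upper_bound]).

    The argument uses that balls have finite mass. In polar coordinates this is
    the integrability of r ^ (alpha + n - 1) at 0. Since surface measure is
    defined by cones, it is obtained from a recursion over annuli, each being
    the union of an outer annulus and of a copy of the previous one shrunk by a
    factor 2 ([posweight_ball_lty]).

    Lower bound. A sign function phi with phi (r x) = eps r * phi x and
    |eps r| = 1 is bounded, hence in BMO, with a positive seminorm when it takes
    both values 1 and -1 on open boxes. The image of phi exists only if psi is
    integrable: comparing its values at points where phi is 1 and -1 removes the
    unknown constants and leaves twice psi in modulus ([bounded_integral_lty]).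
    If eps (s t) is a constant e, then phi is an eigenfunction of the operator,
    with eigenvalue e times the integral of psi ([bound_ge_integral]). The sign
    of one coordinate serves when s does not change sign. For n > 1 the sign of
    the product of two coordinates is invariant under all dilations, whence
    eps = 1 for every s. *)

Set Implicit Arguments.
Unset Strict Implicit.
Unset Printing Implicit Defensive.

Import Order.TTheory GRing.Theory Num.Theory.
Import numFieldNormedType.Exports.

Local Open Scope classical_set_scope.
Local Open Scope ring_scope.
Local Open Scope complex_scope.

(** * Completion of a sigma-finite measure *)

Section completion.
Context d (T : measurableType d) (R : realType).
Variable mu : {measure set T -> \bar R}.
Local Notation cT := (caratheodory_type (mu^*)%mu).
Local Notation cmu := (@completed_measure_extension _ _ _ mu).
Local Open Scope ereal_scope.

Lemma completed_measureE (A : set T) : measurable A -> cmu A = mu A.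
Proof. by move=> mA; exact: measurable_mu_extE. Qed.

Lemma completed_measurable (A : set T) :
  measurable A -> measurable (A : set cT).
Proof. by move=> mA; exact: caratheodory_measurable_mu_ext. Qed.

Lemma completed_measurable_fun d' (T' : measurableType d') (f : T -> T') :
  measurable_fun setT f -> measurable_fun setT (f : cT -> T').
Proof.
by move=> mf _ B mB; apply: completed_measurable; exact: mf.
Qed.

(** The outer measure is an infimum over countable covers, so the intersection
    of covers with masses converging to it has the same measure. *)
Lemma measurable_hull (X : set T) :
  exists F : set T, [/\ measurable F, X `<=` F & mu F = cmu X].
Proof.
have [Xoo|Xoo] := eqVneq (cmu X) +oo.
  exists setT; split => //; apply/eqP; rewrite Xoo eq_le leey/= -Xoo.
  by rewrite -completed_measureE//; exact: le_mu_ext.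
have Xfin : cmu X \is a fin_num.
  by rewrite ge0_fin_numE ?ltey// /completed_measure_extension mu_ext_ge0.
have cover n : exists A : (set T)^nat, [/\ (forall k, measurable (A k)),
    X `<=` \bigcup_k A k & \sum_(k <oo) mu (A k) < cmu X + (n.+1%:R^-1)%:E].
  have n0 : (0 < n.+1%:R^-1 :> R)%R by rewrite invr_gt0.
  have [_ [A [mA XA] <-] ltA] := lb_ereal_inf_adherent n0 Xfin.
  by exists A.
have [A /all_and3[mA XA ltA]] := choice cover.
pose F := \bigcap_n \bigcup_k A n k.
have mF : measurable F.
  by apply: bigcapT_measurable => n; exact: bigcupT_measurable.
have XF : X `<=` F by exact: sub_bigcap.
exists F; split => //; apply/eqP; rewrite eq_le; apply/andP; split; last first.
  by rewrite -completed_measureE//; exact: le_mu_ext.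
apply/lee_addgt0Pr => _/posnumP[e]; near \oo => n.
apply: (@le_trans _ _ (mu (\bigcup_k A n k))).
  apply: le_measure; rewrite ?inE//; first exact: bigcupT_measurable.
  exact: bigcap_inf.
apply: (le_trans (measure_sigma_subadditive mu (mA n) _ (@subset_refl _ _))).
  exact: bigcupT_measurable.
rewrite (le_trans (ltW (ltA n)))// leeD2l// lee_fin ltW//.
by near: n; apply: near_infty_natSinv_lt.
Unshelve. all: by end_near. Qed.

Lemma completed_is_complete : measure_is_complete cmu.
Proof. exact: measure_is_complete_caratheodory. Qed.

Hypothesis sfmu : sigma_finite setT mu.

(** A set of finite measure differs from its measurable hull by a set that is
    itself contained in a measurable null set; sigma-finiteness reduces the
    general case to this one. *)
Lemma completed_measurable_set (E : set cT) : measurable E ->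
  exists B N : set T, [/\ measurable B, measurable N, mu N = 0 &
    E `\` N = B `\` N].
Proof.
have fin_case (G : set cT) : measurable G -> cmu G < +oo ->
    exists B N : set T, [/\ measurable B, measurable N, mu N = 0 &
      G `\` N = B `\` N].
  move=> mG Goo; have [F [mF GF FG]] := measurable_hull G.
  have FG0 : cmu (F `\` G) = 0.
    rewrite measureD//; last 2 first.
    - exact: completed_measurable.
    - by rewrite [X in X < _](completed_measureE mF) FG.
    rewrite setIidr// [X in X - _]completed_measureE// FG subee//.
    by rewrite ge0_fin_numE.
  have [N [mN FGN N0]] := measurable_hull (F `\` G).
  exists F, N; split => //; first by rewrite N0.
  apply/seteqP; split=> x [Ax Nx]; split => //; first exact: GF.
  by apply: contrapT => nGx; apply: Nx; exact: FGN.
move=> mE; have [S ST /all_and2[mS Soo]] := sfmu.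
have /choice[B /choice[N /all_and4[mB mN N0 EBN]]] : forall n, exists B N : set T,
    [/\ measurable B, measurable N, mu N = 0 & (E `&` S n) `\` N = B `\` N].
  move=> n; apply: fin_case.
    by apply: measurableI => //; exact: completed_measurable.
  apply: le_lt_trans (Soo n); rewrite -[leRHS]completed_measureE//.
  by apply: le_mu_ext; exact: subIsetr.
exists (\bigcup_n B n), (\bigcup_n N n); split.
- exact: bigcupT_measurable.
- exact: bigcupT_measurable.
- apply/measure_negligible; first exact: bigcupT_measurable.
  by apply: negligible_bigcup => n; exists (N n); split.
- apply/seteqP; split=> x [Ex Nx]; split => //.
  + have : setT x by []; rewrite ST => -[n _ Snx]; exists n => //.
    suff : (B n `\` N n) x by case.
    by rewrite -EBN; split => // Nnx; apply: Nx; exists n.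
  + case: Ex => n _ Bnx; suff : ((E `&` S n) `\` N n) x by case => -[].
    by rewrite EBN; split => // Nnx; apply: Nx; exists n.
Qed.

(** A real function is determined by its sublevel sets at rational levels, each
    of which is measurable off a null set. The freedom in the choice of N' lets
    one null set serve the real and the imaginary part of a complex function. *)
Lemma completed_measurable_fun_modif (f : cT -> R) : measurable_fun setT f ->
  exists N : set T, [/\ measurable N, mu N = 0 &
    forall N' : set T, measurable N' -> N `<=` N' ->
      measurable_fun setT (fun x : T => if x \in N' then 0%R else f x)].
Proof.
move=> mf; pose q n : R := ratr (odflt 0%R (unpickle n)).
have /choice[B /choice[N /all_and4[mB mN N0 fBN]]] : forall n, exists B N : set T,
    [/\ measurable B, measurable N, mu N = 0 &
       f @^-1` `]-oo, q n[ `\` N = B `\` N].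
  move=> n; apply: completed_measurable_set.
  by rewrite -[X in measurable X]setTI; apply: mf => //; exact: measurable_itv.
exists (\bigcup_n N n); split.
- exact: bigcupT_measurable.
- apply/measure_negligible; first exact: bigcupT_measurable.
  by apply: negligible_bigcup => n; exists (N n); split.
move=> N' mN' NN'; set g := (g in measurable_fun _ g).
have gq n : measurable (g @^-1` `]-oo, q n[).
  rewrite (_ : _ @^-1` _ = (B n `\` N') `|`
      (if (0 < q n)%R then N' else set0)); last first.
    apply/seteqP; split=> x; rewrite /g /= in_itv/=.
      case: ifPn => [/set_mem xN' -> |/negP]; first by right.
      rewrite inE => xN' fxq; left; split => //.
      suff : (B n `\` N n) x by case.
      rewrite -fBN; split; first by rewrite /= in_itv.
      by move=> Nnx; apply: xN'; apply: NN'; exists n.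
    case=> [[Bx xN']|].
      rewrite memNset//.
      have : (B n `\` N n) x by split => // Nnx; apply: xN'; apply: NN'; exists n.
      by rewrite -fBN => -[/=]; rewrite in_itv.
    by case: ifPn => // q0 xN'; rewrite mem_set.
  by apply: measurableU; [exact: measurableD|case: ifPn].
apply: (measurability _ (RGenOInfty.measurableE R)) => _ [_ [r ->] <-].
rewrite setTI (_ : _ @^-1` _ =
   \bigcup_(n in [set n | (r < q n)%R]) ~` (g @^-1` `]-oo, q n[)).
  by apply: bigcup_measurable => n _; exact: measurableC.
apply/seteqP; split=> x /=; rewrite in_itv/= andbT.
  move=> rg; have [p rpg] := rat_in_itvoo rg.
  move: rpg; rewrite in_itv/= => /andP[rp pg].
  exists (pickle p) => /=; rewrite /q pickleK//= in_itv/=.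
  by apply/negP; rewrite -leNgt ltW.
move=> [n /= rq]; rewrite in_itv/= => /negP; rewrite -leNgt.
exact: lt_le_trans.
Qed.

End completion.

(** * Dilations of the line and boxes *)

Section change_of_variables.
Context d d' (X : measurableType d) (Y : measurableType d') (R : realType).
Variables (m : {measure set X -> \bar R}) (m' : {measure set Y -> \bar R}).
Variables (phi : X -> Y) (c : R).
Hypotheses (mphi : measurable_fun setT phi) (c_ge0 : 0 <= c).
Hypothesis phiE : forall A, measurable A -> m (phi @^-1` A) = (c%:E * m' A)%E.
Local Open Scope ereal_scope.

Lemma ge0_integral_change D (f : Y -> \bar R) :
  measurable D -> measurable_fun D f -> (forall y, D y -> 0 <= f y) ->
  \int[m]_(x in phi @^-1` D) f (phi x) = c%:E * \int[m']_(y in D) f y.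
Proof.
move=> mD mf f0.
rewrite -(ge0_integral_pushforward mphi m)//; last by move=> y /set_mem; exact: f0.
transitivity (\int[mscale (NngNum c_ge0) m']_(y in D) f y).
  by apply: eq_measure_integral => A mA _; exact: phiE.
by rewrite ge0_integral_mscale.
Qed.

Lemma integrable_change D (f : Y -> \bar R) :
  measurable D -> m'.-integrable D f ->
  m.-integrable (phi @^-1` D) (f \o phi).
Proof.
move=> mD /integrableP[mf fi].
have mphiD : measurable (phi @^-1` D).
  by rewrite -[X in measurable X]setTI; exact: mphi.
apply/integrableP; split.
  apply: (measurable_comp mD) => //; first by move=> _ [x Dx <-].
  exact: measurable_funS mphi.
rewrite (@ge0_integral_change D (abse \o f)) => [|//||y _ /=]; first 1 last.
- exact: measurableT_comp.
- exact: abse_ge0.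
by rewrite lte_mul_pinfty// lee_fin.
Qed.

Lemma integral_change D (f : Y -> \bar R) :
  measurable D -> m'.-integrable D f ->
  \int[m]_(x in phi @^-1` D) f (phi x) = c%:E * \int[m']_(y in D) f y.
Proof.
move=> mD fi; have mf := measurable_int _ fi.
rewrite integralE [in RHS]integralE muleBr//; last first.
  apply: fin_num_adde_defl; rewrite fin_numN.
  exact: integrable_neg_fin_num.
have Ep := ge0_integral_change mD (measurable_funepos mf)
  (fun y _ => funepos_ge0 f y).
have En := ge0_integral_change mD (measurable_funeneg mf)
  (fun y _ => funeneg_ge0 f y).
rewrite -Ep -En.
by congr (_ - _); apply: eq_integral => x _; rewrite ?funeposE ?funenegE.
Qed.

Lemma Rintegral_change D (f : Y -> R) :
  measurable D -> m'.-integrable D (EFin \o f) ->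
  (\int[m]_(x in phi @^-1` D) f (phi x) = c * \int[m']_(y in D) f y)%R.
Proof.
move=> mD fi; rewrite /Rintegral (integral_change mD fi) fineM//.
exact: integrable_fin_num.
Qed.

End change_of_variables.

Section dilation_1d.
Context (R : realType).
Local Open Scope ereal_scope.

Lemma measurable_mull (s : R) :
  measurable_fun [set: measurableTypeR R] ( *%R s : _ -> measurableTypeR R).
Proof. exact: mulrl_measurable. Qed.

(** Uniqueness of Lebesgue measure from its values on half-open intervals; a
    negative factor exchanges the two ends of an interval. *)
Lemma lebesgue_measure_dilation (s : R) (A : set (measurableTypeR R)) :
  s != 0%R -> measurable A ->
  lebesgue_measure ( *%R s @^-1` A) = (`|s|^-1)%:E * lebesgue_measure A.
Proof.
move=> s0 mA.
have s_gt0 : (0 < `|s|)%R by rewrite normr_gt0.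
pose m := mscale (NngNum (ltW s_gt0))
  (measure_function_pushforward__canonical__measure_function_Measure
     (@lebesgue_measure R) (measurable_mull s)).
have mE : forall X, ocitv X -> lebesgue_measure X = m X.
  move=> X /ocitvP[->|[[a b] /= ab ->]]; first by rewrite !measure0.
  have -> : forall Y, m Y = `|s|%:E * lebesgue_measure ( *%R s @^-1` Y) by [].
  have [sp|sn] : ((0 < s) \/ (s < 0))%R by move: s0; rewrite neq_lt => /orP[]; [right|left].
    rewrite (_ : _ @^-1` _ = `]a / s, b / s]%classic)%R; last first.
      apply/seteqP; split=> x /=; rewrite !in_itv/= ltr_pdivrMr// ler_pdivlMr//;
      by rewrite mulrC.
    rewrite !lebesgue_measure_itv/= !lte_fin ltr_pM2r ?invr_gt0// ab.
    by rewrite -!EFinB -EFinM gtr0_norm// -mulrBl mulrC divfK.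
  rewrite (_ : _ @^-1` _ = `[b / s, a / s[%classic)%R; last first.
    apply/seteqP; split=> x /=; rewrite !in_itv/= ltr_ndivlMr// ler_ndivrMr//;
    by rewrite mulrC andbC.
  rewrite !lebesgue_measure_itv/= !lte_fin ltr_nM2r ?invr_lt0// ab.
  rewrite -!EFinB -EFinM ltr0_norm// -mulrBl mulrC mulrN divfK ?lt_eqF//.
  by rewrite opprB.
rewrite (lebesgue_measure_unique mE mA) /m /mscale/= muleA -EFinM mulVf ?mul1e//.
by rewrite gt_eqF.
Qed.

End dilation_1d.

Section boxes.
Context (R : realType).
Local Notation mR := (measurableTypeR R).
Local Open Scope ereal_scope.

Lemma measurable_scalev n (s : R) :
  measurable_fun [set: n.-tuple mR] (scalev s : _ -> n.-tuple mR).
Proof.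
apply/measurable_fun_tnthP => i.
rewrite (_ : _ \o _ = ( *%R s) \o (fun x : n.-tuple mR => tnth x i)).
  exact: measurableT_comp (measurable_mull s) (measurable_tnth i).
by apply/funext => x /=; rewrite tnth_mktuple.
Qed.

Definition boxv n (a b : 'I_n -> R) : set (n.-tuple R) :=
  [set x | forall i, (a i < tnth x i < b i)%R].

Lemma measurable_boxv n (a b : 'I_n -> R) :
  measurable (boxv a b : set (n.-tuple mR)).
Proof.
rewrite (_ : boxv a b = \big[setI/setT]_(i < n)
    ((fun x : n.-tuple mR => tnth x i) @^-1` `]a i, b i[)).
  apply: bigsetI_measurable => i _; rewrite -[X in measurable X]setTI.
  by apply: measurable_tnth => //; exact: measurable_itv.
apply/seteqP; split=> x /=.
  move=> bx; elim/big_rec: _ => //= i X _ Xx; split => //.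
  by rewrite /= in_itv/=; exact: bx.
by move=> bx i; move: bx; rewrite (bigD1 i)//= => -[]; rewrite /= in_itv.
Qed.

Lemma borel_lebesgue_box n (a b : 'I_n -> R) : (forall i, a i <= b i)%R ->
  borel_lebesgue (boxv a b) = (\prod_(i < n) (b i - a i)%R)%:E.
Proof.
elim: n a b => [|n ih] a b ab.
  by rewrite big_ord0 /= diracE mem_set// => -[].
rewrite /= /pushforward big_ord_recl.
rewrite (_ : _ @^-1` _ = boxv (a \o lift ord0) (b \o lift ord0) `*`
     `]a ord0, b ord0[%classic); last first.
  apply/seteqP; split=> [x bx|x [/= bx]]; rewrite ?in_itv/=.
    split=> /= [i|]; last by have := bx ord0; rewrite in_itv.
    by have := bx (lift ord0 i); rewrite /consv/= tnthS.
  by move=> ax i; case: (unliftP ord0 i) => [j ->|->] //; rewrite tnthS; apply: bx.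
rewrite (@product_measure1E _ _ _ _ _ (@borel_lebesgue R n))//;
  last exact: measurable_boxv.
rewrite [X in X * _](_ : _ =
    (\prod_(i < n) (b (lift ord0 i) - a (lift ord0 i))%R)%:E); last first.
  by apply: ih => i; exact: ab.
rewrite [X in _ * X](_ : _ = (b ord0 - a ord0)%:E); first by rewrite mulrC EFinM.
apply: etrans (lebesgue_measure_itv `]a ord0, b ord0[) _.
rewrite /= lte_fin -EFinB.
by case: ltgtP (ab ord0) => //= -> _; rewrite subrr.
Qed.

End boxes.

(** * Lebesgue measure under dilations *)

Section Rn_dilation.
Context (R : realType).
Local Notation mR := (measurableTypeR R).
Local Open Scope ereal_scope.

Lemma borel_lebesgue_sigma_finite n :
  sigma_finite setT (@borel_lebesgue R n).
Proof.
exists (fun k => boxv (fun=> - k%:R)%R (fun=> k%:R)%R).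
  apply/esym/seteqP; split => // x _.
  pose M := (\sum_(i < n) `|tnth x i|)%R.
  have [k Mk] : exists k : nat, (M < k%:R)%R.
    by exists (Num.bound `|M|); exact: le_lt_trans (ler_norm _) (archi_boundP (normr_ge0 M)).
  exists k => // i; rewrite -ltr_norml; apply: le_lt_trans Mk.
  by rewrite /M (bigD1 i)//= lerDl sumr_ge0.
move=> k; split; first exact: measurable_boxv.
by rewrite borel_lebesgue_box ?ltry// => i; rewrite ge0_cp.
Qed.

(** Induction on the dimension, one coordinate being split off: the sections of
    the dilated set are dilated sections. *)
Lemma borel_lebesgue_dilation n (s : R) (A : set (n.-tuple mR)) :
  s != 0%R -> measurable A ->
  borel_lebesgue (scalev s @^-1` A) = ((`|s| ^- n)%R)%:E * borel_lebesgue A.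
Proof.
move=> s0; elim: n A => [|n ih] A mA.
  rewrite expr0 invr1 mul1e /=; congr (\d_ _ _).
  by apply/seteqP; split => x /=; rewrite (tuple0 x) (tuple0 (scalev _ _)).
have mscale_n := @measurable_scalev R n s.
have mcons : measurable (@consv R n @^-1` A : set (n.-tuple mR * mR)).
  by rewrite -[X in measurable X]setTI; exact: measurable_consv.
rewrite /= /pushforward /product_measure1.
transitivity (\int[@borel_lebesgue R n]_x
    ((`|s|^-1)%:E * lebesgue_measure (xsection (@consv R n @^-1` A) (scalev s x)))).
  apply: eq_integral => x _ /=.
  rewrite -lebesgue_measure_dilation//; last exact: measurable_xsection.
  congr (lebesgue_measure _); apply/seteqP; split => r;
    rewrite /xsection /= !inE /=; congr A; apply: eq_from_tnth => i;
    case: (unliftP ord0 i) => [j|] ->;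
    by rewrite ?tnth_mktuple /consv /= ?tnthS ?tnth_mktuple ?tnth0.
rewrite ge0_integralZl//.
- rewrite (ge0_integral_change mscale_n _ ih (D := setT)
     (f := fun x => lebesgue_measure (xsection (@consv R n @^-1` A) x)))//.
  + by rewrite muleA -EFinM exprS invfM.
  + exact: measurable_fun_xsection.
- apply: (measurableT_comp (f := fun x => lebesgue_measure (xsection (@consv R n @^-1` A) x))) => //.
  exact: measurable_fun_xsection.
Qed.

HB.instance Definition _ n :=
  @Measure_isSigmaFinite.Build _ _ _ (@borel_lebesgue R n)
    (@borel_lebesgue_sigma_finite n).

Lemma lebesgue_Rn_sigma_finite n : sigma_finite setT (lebesgue_Rn R n).
Proof.
exact: completed_measure_extension_sigma_finite (@borel_lebesgue_sigma_finite n).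
Qed.

HB.instance Definition _ n :=
  @Measure_isSigmaFinite.Build _ _ _ (lebesgue_Rn R n)
    (@lebesgue_Rn_sigma_finite n).

Lemma lebesgue_Rn_complete n : measure_is_complete (lebesgue_Rn R n).
Proof. exact: completed_is_complete. Qed.

Lemma lebesgue_RnE n (A : set (n.-tuple mR)) : measurable A ->
  lebesgue_Rn R n A = borel_lebesgue A.
Proof. exact: completed_measureE. Qed.

Lemma measurable_Rn n (A : set (n.-tuple mR)) : measurable A ->
  measurable (A : set (Rn R n)).
Proof. exact: completed_measurable. Qed.

Lemma measurable_fun_Rn n d' (T' : measurableType d') (f : n.-tuple mR -> T') :
  measurable_fun setT f -> measurable_fun setT (f : Rn R n -> T').
Proof. exact: completed_measurable_fun. Qed.

(** A Lebesgue set is Borel off a Borel null set, and the preimage of that null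
    set is null by the scaling law for Borel sets. *)
Lemma measurable_scalev_Rn n (s : R) : s != 0%R ->
  measurable_fun setT (scalev s : Rn R n -> Rn R n).
Proof.
move=> s0 _ A mA; rewrite setTI.
have [B [N [mB mN N0 AB]]] :=
  completed_measurable_set (@borel_lebesgue_sigma_finite n) mA.
have pre (C : set (n.-tuple mR)) : measurable C ->
    measurable (scalev s @^-1` C : set (n.-tuple mR)).
  by move=> mC; rewrite -[X in measurable X]setTI; exact: measurable_scalev.
rewrite (_ : _ @^-1` _ = (scalev s @^-1` B `\` scalev s @^-1` N) `|`
    (scalev s @^-1` A `&` scalev s @^-1` N)); last first.
  apply/seteqP; split=> x /=.
    move=> Ax; have [Nx|Nx] := pselect (N (scalev s x)); [by right|left].
    by rewrite -[_ /\ _]/((B `\` N) (scalev s x)) -AB.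
  move=> [|[]//]; rewrite -[_ /\ _]/((B `\` N) (scalev s x)) -AB.
  by case.
apply: measurableU; first by apply: measurable_Rn; apply: measurableD; exact: pre.
apply: lebesgue_Rn_complete; exists (scalev s @^-1` N); split => //.
- by apply: measurable_Rn; apply: pre.
- rewrite lebesgue_RnE; last exact: pre.
  by rewrite borel_lebesgue_dilation// [X in _ * X]N0 mule0.
Qed.

Lemma lebesgue_Rn_dilation n (s : R) (A : set (Rn R n)) :
  s != 0%R -> measurable A ->
  lebesgue_Rn R n (scalev s @^-1` A) = ((`|s| ^- n)%R)%:E * lebesgue_Rn R n A.
Proof.
move=> s0 mA.
have [B [N [mB mN N0 AB]]] :=
  completed_measurable_set (@borel_lebesgue_sigma_finite n) mA.
have pre (C : set (n.-tuple mR)) : measurable C ->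
    measurable (scalev s @^-1` C : set (n.-tuple mR)).
  by move=> mC; rewrite -[X in measurable X]setTI; exact: measurable_scalev.
have off (D M : set (Rn R n)) : measurable D -> measurable M ->
    lebesgue_Rn R n M = 0 -> lebesgue_Rn R n D = lebesgue_Rn R n (D `\` M).
  move=> mD mM M0; rewrite (measureDI _ mD mM).
  rewrite [X in _ + X](_ : _ = 0) ?adde0//.
  by apply: (subset_measure0 _ mM _ M0) => //; exact: measurableI.
rewrite (off _ (scalev s @^-1` N)); first last.
- rewrite lebesgue_RnE; last exact: pre.
  by rewrite borel_lebesgue_dilation// [X in _ * X]N0 mule0.
- by apply: measurable_Rn; apply: pre.
- by rewrite -[X in measurable X]setTI; exact: measurable_scalev_Rn.
rewrite (off A N)//; first last.
- by rewrite lebesgue_RnE.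
- exact: measurable_Rn.
have -> : scalev s @^-1` A `\` scalev s @^-1` N = scalev s @^-1` (B `\` N).
  by rewrite -AB.
rewrite AB !lebesgue_RnE; last 2 first.
- exact: measurableD.
- by apply: pre; exact: measurableD.
by rewrite borel_lebesgue_dilation//; exact: measurableD.
Qed.

End Rn_dilation.

#[local] Instance ae_lebesgue_Rn_filter (R : realType) n :
  Filter (nbhs (almost_everywhere (lebesgue_Rn R n))).
Proof. exact: ae_filter_ringOfSetsType. Qed.

#[local] Instance ae_completed_lebesgue_filter (R : realType) :
  Filter (nbhs (almost_everywhere (@completed_lebesgue_measure R))).
Proof. exact: ae_filter_ringOfSetsType. Qed.

(** * Complex-valued integration *)

Section complex_arith.
Context (R : realType).
Implicit Types (z k : R[i]) (a : R).

Lemma cReB z k : complex.Re (z - k) = complex.Re z - complex.Re k.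
Proof. by case: z k => [? ?] [? ?]. Qed.
Lemma cImB z k : complex.Im (z - k) = complex.Im z - complex.Im k.
Proof. by case: z k => [? ?] [? ?]. Qed.
Lemma cReD z k : complex.Re (z + k) = complex.Re z + complex.Re k.
Proof. by case: z k => [? ?] [? ?]. Qed.
Lemma cImD z k : complex.Im (z + k) = complex.Im z + complex.Im k.
Proof. by case: z k => [? ?] [? ?]. Qed.
Lemma cReM z k : complex.Re (z * k) =
  complex.Re z * complex.Re k - complex.Im z * complex.Im k.
Proof. by case: z k => [? ?] [? ?]. Qed.
Lemma cImM z k : complex.Im (z * k) =
  complex.Re z * complex.Im k + complex.Im z * complex.Re k.
Proof. by case: z k => [? ?] [? ?]. Qed.
Lemma cReMr z a : complex.Re (z * a%:C) = complex.Re z * a.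
Proof. by rewrite cReM /= mulr0 subr0. Qed.
Lemma cImMr z a : complex.Im (z * a%:C) = complex.Im z * a.
Proof. by rewrite cImM /= mulr0 add0r. Qed.

Lemma complexP z k : complex.Re z = complex.Re k ->
  complex.Im z = complex.Im k -> z = k.
Proof. by case: z k => [? ?] [? ?] /= -> ->. Qed.

Lemma normcE z :
  Normc.normc z = Num.sqrt (complex.Re z ^+ 2 + complex.Im z ^+ 2).
Proof. by case: z. Qed.

Lemma normc_ge0 z : 0 <= Normc.normc z.
Proof. by rewrite normcE sqrtr_ge0. Qed.

Lemma normc_eq0_eq0 z : Normc.normc z = 0 -> z = 0.
Proof.
rewrite normcE => /eqP; rewrite sqrtr_eq0 => z0.
by apply: complexP; apply/eqP; rewrite -sqrf_eq0 eq_le sqr_ge0 andbT;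
  apply: le_trans z0; rewrite ?lerDl ?lerDr sqr_ge0.
Qed.

Lemma normc_real a : Normc.normc a%:C = `|a|.
Proof. by rewrite normcE /= expr0n addr0 sqrtr_sqr. Qed.

Lemma ler_normc_Re z : `|complex.Re z| <= Normc.normc z.
Proof.
rewrite normcE -sqrtr_sqr ler_wsqrtr// lerDl; exact: sqr_ge0.
Qed.

Lemma ler_normc_Im z : `|complex.Im z| <= Normc.normc z.
Proof.
rewrite normcE -sqrtr_sqr ler_wsqrtr// lerDr; exact: sqr_ge0.
Qed.

Lemma ler_normc_add z : Normc.normc z <= `|complex.Re z| + `|complex.Im z|.
Proof.
have h : 0 <= `|complex.Re z| + `|complex.Im z| by rewrite addr_ge0.
rewrite normcE -(ger0_norm h) -sqrtr_sqr ler_wsqrtr//.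
rewrite sqrrD !real_normK ?num_real// -addrA (addrC (_ *+ 2)) addrA lerDl.
by rewrite mulrn_wge0// mulr_ge0.
Qed.

(** The Cauchy-Schwarz inequality: the modulus bounds every real linear
    functional of norm one. *)
Lemma ler_normc_dual z (a b : R) : a ^+ 2 + b ^+ 2 = 1 ->
  a * complex.Re z + b * complex.Im z <= Normc.normc z.
Proof.
move=> ab1; rewrite normcE; set x := complex.Re z; set y := complex.Im z.
apply: le_trans (ler_norm _) _; rewrite -sqrtr_sqr ler_wsqrtr//.
have : 0 <= (a * y - b * x) ^+ 2 by exact: sqr_ge0.
suff -> : x ^+ 2 + y ^+ 2 = (a ^+ 2 + b ^+ 2) * (x ^+ 2 + y ^+ 2) by nra.
by rewrite ab1 mul1r.
Qed.

End complex_arith.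

Section complex_measurability.
Context d (T : measurableType d) (R : realType).
Implicit Types (D : set T) (f g : T -> R[i]).

Lemma cmeasurable_funS D D' f : measurable D -> D' `<=` D ->
  cmeasurable_fun D f -> cmeasurable_fun D' f.
Proof.
by move=> mD DD' [mr mi]; split; [exact: measurable_funS mr|exact: measurable_funS mi].
Qed.

Lemma cmeasurable_funB D f g : cmeasurable_fun D f -> cmeasurable_fun D g ->
  cmeasurable_fun D (fun x => f x - g x).
Proof.
move=> [fr fi] [gr gi]; split.
  under eq_fun do rewrite cReB; exact: measurable_funB.
under eq_fun do rewrite cImB; exact: measurable_funB.
Qed.

Lemma cmeasurable_funMr D f (h : T -> R) : cmeasurable_fun D f ->
  measurable_fun D h -> cmeasurable_fun D (fun x => f x * (h x)%:C).
Proof.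
move=> [fr fi] mh; split.
  under eq_fun do rewrite cReMr; exact: measurable_funM.
under eq_fun do rewrite cImMr; exact: measurable_funM.
Qed.

Lemma cmeasurable_cst D (k : R[i]) : cmeasurable_fun D (fun=> k).
Proof. by split; exact: measurable_cst. Qed.

Lemma measurable_normc D f : cmeasurable_fun D f ->
  measurable_fun D (fun x => Normc.normc (f x)).
Proof.
move=> [fr fi]; under eq_fun do rewrite normcE.
apply: measurableT_comp.
  by apply: continuous_measurable_fun => x; exact: sqrt_continuous.
by apply: measurable_funD; exact: measurable_funX.
Qed.

End complex_measurability.

Section complex_integral_theory.
Context d (T : measurableType d) (R : realType).
Variable mu : {measure set T -> \bar R}.
Implicit Types (D : set T) (f g : T -> R[i]).

Lemma cintegrable_cmeasurable D f : cintegrable mu D f -> cmeasurable_fun D f.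
Proof.
by move=> [fr fi]; split; apply/measurable_EFinP;
  [exact: measurable_int fr|exact: measurable_int fi].
Qed.

Lemma cintegrableP D f : measurable D ->
  cintegrable mu D f <-> cmeasurable_fun D f /\
  (\int[mu]_(x in D) (Normc.normc (f x))%:E < +oo)%E.
Proof.
move=> mD; split=> [if_|[mf foo]].
  have mf := cintegrable_cmeasurable if_; split => //.
  have [/integrableP[_ fr] /integrableP[_ fi]] := if_; case: (mf) => mr mi.
  apply: (@le_lt_trans _ _ (\int[mu]_(x in D)
     (`|(complex.Re (f x))%:E| + `|(complex.Im (f x))%:E|)))%E.
    apply: ge0_le_integral => //=.
    - by move=> x _; rewrite lee_fin normc_ge0.
    - by apply/measurable_EFinP; exact: measurable_normc.
    - by apply/measurable_EFinP; apply: measurable_funD; exact: measurableT_comp.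
    - by move=> x _; rewrite lee_fin; exact: ler_normc_add.
  rewrite ge0_integralD//; first exact: lte_add_pinfty.
  - by apply: measurableT_comp => //; exact/measurable_EFinP.
  - by apply: measurableT_comp => //; exact/measurable_EFinP.
have inorm : mu.-integrable D (fun x => (Normc.normc (f x))%:E).
  apply/integrableP; split; first by apply/measurable_EFinP; exact: measurable_normc.
  by under eq_integral do rewrite gee0_abs ?lee_fin ?normc_ge0//.
split; apply: le_integrable inorm => //.
- by apply/measurable_EFinP; case: mf.
- by move=> x _; rewrite lee_fin [leRHS]ger0_norm ?normc_ge0// ler_normc_Re.
- by apply/measurable_EFinP; case: mf.
- by move=> x _; rewrite lee_fin [leRHS]ger0_norm ?normc_ge0// ler_normc_Im.
Qed.

Lemma cintegrableS D D' f : measurable D -> measurable D' -> D' `<=` D ->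
  cintegrable mu D f -> cintegrable mu D' f.
Proof.
by move=> mD mD' DD' [fr fi]; split; [exact: integrableS fr|exact: integrableS fi].
Qed.

Lemma eq_cintegrable D f g : measurable D -> {in D, f =1 g} ->
  cintegrable mu D f -> cintegrable mu D g.
Proof.
move=> mD fg [fr fi]; split.
  by apply: eq_integrable fr => // x /fg ->.
by apply: eq_integrable fi => // x /fg ->.
Qed.

Lemma eq_cintegral D f g : {in D, f =1 g} ->
  cintegral mu D f = cintegral mu D g.
Proof.
by move=> fg; congr (_ +i* _); apply: eq_Rintegral => x /fg ->.
Qed.

Lemma cintegrableB D f g : measurable D -> cintegrable mu D f ->
  cintegrable mu D g -> cintegrable mu D (fun x => f x - g x).
Proof.
move=> mD [fr fi] [gr gi]; split.
  by under eq_fun do rewrite cReB EFinB; exact: integrableB.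
by under eq_fun do rewrite cImB EFinB; exact: integrableB.
Qed.

Lemma cintegralB D f g : measurable D -> cintegrable mu D f ->
  cintegrable mu D g ->
  cintegral mu D (fun x => f x - g x) = cintegral mu D f - cintegral mu D g.
Proof.
move=> mD [fr fi] [gr gi]; apply: complexP; rewrite ?cReB ?cImB /=.
  by under eq_Rintegral do rewrite cReB; rewrite RintegralB.
by under eq_Rintegral do rewrite cImB; rewrite RintegralB.
Qed.

Lemma cintegrableD D f g : measurable D -> cintegrable mu D f ->
  cintegrable mu D g -> cintegrable mu D (fun x => f x + g x).
Proof.
move=> mD [fr fi] [gr gi]; split.
  by under eq_fun do rewrite cReD EFinD; exact: integrableD.
by under eq_fun do rewrite cImD EFinD; exact: integrableD.
Qed.

Lemma cintegralD D f g : measurable D -> cintegrable mu D f ->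
  cintegrable mu D g ->
  cintegral mu D (fun x => f x + g x) = cintegral mu D f + cintegral mu D g.
Proof.
move=> mD [fr fi] [gr gi]; apply: complexP; rewrite ?cReD ?cImD /=.
  by under eq_Rintegral do rewrite cReD; rewrite RintegralD.
by under eq_Rintegral do rewrite cImD; rewrite RintegralD.
Qed.

Lemma cintegrableZ D (k : R[i]) (h : T -> R) : measurable D ->
  mu.-integrable D (EFin \o h) -> cintegrable mu D (fun x => k * (h x)%:C).
Proof.
move=> mD ih; split.
  by under eq_fun do rewrite cReMr EFinM; exact: integrableZl.
by under eq_fun do rewrite cImMr EFinM; exact: integrableZl.
Qed.

Lemma cintegralZ D (k : R[i]) (h : T -> R) : measurable D ->
  mu.-integrable D (EFin \o h) ->
  cintegral mu D (fun x => k * (h x)%:C) = k * (\int[mu]_(x in D) h x)%:C.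
Proof.
move=> mD ih; apply: complexP; rewrite ?cReMr ?cImMr /=.
  by under eq_Rintegral do rewrite cReMr; rewrite RintegralZl.
by under eq_Rintegral do rewrite cImMr; rewrite RintegralZl.
Qed.

Lemma ae_eq_cintegral D f g : measurable D -> cmeasurable_fun D f ->
  cmeasurable_fun D g -> ae_eq mu D f g ->
  cintegral mu D f = cintegral mu D g.
Proof.
move=> mD [fr fi] [gr gi] fg; congr (_ +i* _); rewrite /Rintegral; congr fine;
  apply: ae_eq_integral => //; try exact/measurable_EFinP.
- by apply: filterS fg => x /[apply] ->.
- by apply: filterS fg => x /[apply] ->.
Qed.

Lemma ae_eq_cintegrable D f g : measurable D -> cmeasurable_fun D g ->
  ae_eq mu D f g -> cintegrable mu D f -> cintegrable mu D g.
Proof.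
move=> mD mg fg /(cintegrableP _ mD)[mf foo]; apply/cintegrableP => //; split => //.
rewrite (_ : (\int[mu]_(x in D) _ = \int[mu]_(x in D) (Normc.normc (f x))%:E)%E)//.
apply: ae_eq_integral => //; try by apply/measurable_EFinP; exact: measurable_normc.
by apply: filterS fg => x /[apply] ->.
Qed.

(** The real linear functional of norm one that is maximal at the integral takes
    there the modulus as value, and it commutes with integration. *)
Lemma normc_cintegral_le D f : measurable D -> cintegrable mu D f ->
  ((Normc.normc (cintegral mu D f))%:E <=
   \int[mu]_(x in D) (Normc.normc (f x))%:E)%E.
Proof.
move=> mD if_; set z := cintegral mu D f.
have [z0|z0] := eqVneq (Normc.normc z) 0.
  by rewrite z0; apply: integral_ge0 => x _; rewrite lee_fin normc_ge0.
have [mf foo] := (cintegrableP f mD).1 if_; have [fr fi] := if_.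
pose a := complex.Re z / Normc.normc z; pose b := complex.Im z / Normc.normc z.
have z2 : Normc.normc z ^+ 2 = complex.Re z ^+ 2 + complex.Im z ^+ 2.
  by rewrite normcE sqr_sqrtr// addr_ge0 ?sqr_ge0.
have ab : a ^+ 2 + b ^+ 2 = 1.
  by rewrite /a /b !expr_div_n -mulrDl -z2 divff// expf_neq0.
have -> : Normc.normc z = a * complex.Re z + b * complex.Im z.
  by apply: (mulIf z0); rewrite -expr2 z2 /a /b mulrDl mulrAC divfK// mulrAC divfK.
have iZ c (h : T -> R) : mu.-integrable D (EFin \o h) ->
    mu.-integrable D (EFin \o (fun x => c * h x)).
  by move=> ih; have := integrableZl mD c ih.
rewrite /z /= -RintegralZl// -[X in (_ + X)%R]RintegralZl// -RintegralD//;
  [|exact: iZ|exact: iZ].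
have ii : mu.-integrable D
    (fun x => (a * complex.Re (f x) + b * complex.Im (f x))%:E).
  by under eq_fun do rewrite EFinD; apply: integrableD => //; exact: iZ.
rewrite /Rintegral fineK; last exact: integrable_fin_num.
apply: le_integral => //.
  apply/integrableP; split; first by apply/measurable_EFinP; exact: measurable_normc.
  by under eq_integral do rewrite gee0_abs ?lee_fin ?normc_ge0//.
by move=> x _; rewrite lee_fin; exact: ler_normc_dual.
Qed.

Hypothesis cmu : measure_is_complete mu.

Lemma complete_cmeasurable D f g : ae_eq mu D f g ->
  cmeasurable_fun D f -> cmeasurable_fun D g.
Proof.
move=> fg [fr fi]; split; apply/measurable_EFinP.
- apply: (ae_measurable_fun cmu (f := EFin \o (fun x => complex.Re (f x)))).
    by apply: filterS fg => x /[apply] /= ->.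
  exact/measurable_EFinP.
- apply: (ae_measurable_fun cmu (f := EFin \o (fun x => complex.Im (f x)))).
    by apply: filterS fg => x /[apply] /= ->.
  exact/measurable_EFinP.
Qed.

Lemma complete_cintegrable D f g : measurable D -> ae_eq mu D f g ->
  cintegrable mu D f -> cintegrable mu D g.
Proof.
move=> mD fg if_; apply: (ae_eq_cintegrable mD _ fg if_).
exact: complete_cmeasurable (fg) (cintegrable_cmeasurable if_).
Qed.

Lemma complete_cintegral D f g : measurable D -> ae_eq mu D f g ->
  cintegrable mu D f -> cintegral mu D f = cintegral mu D g.
Proof.
move=> mD fg if_; have mf := cintegrable_cmeasurable if_.
by apply: ae_eq_cintegral => //; exact: complete_cmeasurable fg mf.
Qed.

End complex_integral_theory.

(** * Averages of a family of functions *)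

(** Given a kernel h on X * T, a weight W on X and a density P on T, these
    lemmas transfer properties of the functions h (., t) to their average G with
    density P. The assumptions on h (., t) concern only the t with P t != 0,
    because s will be extended by 0 outside the unit interval, where P vanishes. *)
Section fubini_averages.
Context d1 d2 (X : measurableType d1) (T : measurableType d2) (R : realType).
Variable m1 : {sigma_finite_measure set X -> \bar R}.
Variable m2 : {sigma_finite_measure set T -> \bar R}.
Local Open Scope ereal_scope.

Lemma measurable_integral_sndT (f : X * T -> \bar R) : measurable_fun setT f ->
  measurable_fun setT (fun x => \int[m2]_t f (x, t)).
Proof.
move=> mf; under eq_fun do rewrite integralE.
apply: emeasurable_funB.
  rewrite (_ : (fun x => _) = fubini_F m2 (f^\+)).
    by apply: measurable_fun_fubini_tonelli_F => //; exact: measurable_funepos.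
  by apply/funext => x; apply: eq_integral => t _; rewrite !funeposE.
rewrite (_ : (fun x => _) = fubini_F m2 (f^\-)).
  by apply: measurable_fun_fubini_tonelli_F => //; exact: measurable_funeneg.
by apply/funext => x; apply: eq_integral => t _; rewrite !funenegE.
Qed.

Lemma measurable_integral_fstT (f : X * T -> \bar R) : measurable_fun setT f ->
  measurable_fun setT (fun t => \int[m1]_x f (x, t)).
Proof.
move=> mf; under eq_fun do rewrite integralE.
apply: emeasurable_funB.
  rewrite (_ : (fun x => _) = fubini_G m1 (f^\+)).
    by apply: measurable_fun_fubini_tonelli_G => //; exact: measurable_funepos.
  by apply/funext => x; apply: eq_integral => t _; rewrite !funeposE.
rewrite (_ : (fun x => _) = fubini_G m1 (f^\-)).
  by apply: measurable_fun_fubini_tonelli_G => //; exact: measurable_funeneg.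
by apply/funext => x; apply: eq_integral => t _; rewrite !funenegE.
Qed.

Lemma measurable_Rintegral_fstT (f : X * T -> R) : measurable_fun setT f ->
  measurable_fun setT (fun t => (\int[m1]_x f (x, t))%R).
Proof.
move=> mf; apply: (measurableT_comp (f := fine)) => //=.
by apply: (measurable_integral_fstT (f := fun z => (f z)%:E)); exact/measurable_EFinP.
Qed.

Lemma measurable_section_fst d (Y : measurableType d) (f : X * T -> Y) t :
  measurable_fun setT f -> measurable_fun setT (fun x => f (x, t)).
Proof. by move=> mf; apply: (measurableT_comp mf); exact: pair2_measurable. Qed.

Lemma measurable_section_snd d (Y : measurableType d) (f : X * T -> Y) x :
  measurable_fun setT f -> measurable_fun setT (fun t => f (x, t)).
Proof. by move=> mf; apply: (measurableT_comp mf); exact: pair1_measurable. Qed.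

Variables (W : X -> R) (P : T -> R).
Hypotheses (mW : measurable_fun setT W) (mP : measurable_fun setT P).
Hypotheses (W_ge0 : forall x, (0 <= W x)%R) (P_ge0 : forall t, (0 <= P t)%R).

Let measurable_weighted (r : X * T -> R) : measurable_fun setT r ->
  measurable_fun setT (fun z => (r z * W z.1 * P z.2)%:E).
Proof.
move=> mr; apply/measurable_EFinP; apply: measurable_funM.
  by apply: measurable_funM => //; exact: measurableT_comp.
exact: measurableT_comp.
Qed.

(** Exchanging the integrals leaves, for each t, P t times the weighted integral
    of r (., t), which is zero. *)
Lemma integral_weighted_average0 (r : X * T -> R) :
  measurable_fun setT r ->
  (m1 \x m2).-integrable setT (fun z => (r z * W z.1 * P z.2)%:E) ->
  {ae m2, forall t, P t != 0%R -> \int[m1]_x (r (x, t) * W x)%:E = 0} ->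
  {ae m1, forall x, W x != 0%R ->
     m2.-integrable setT (fun t => (r (x, t) * P t)%:E)} ->
  \int[m1]_x ((\int[m2]_t (r (x, t) * P t))%R * W x)%:E = 0.
Proof.
move=> mr ir r0 irt.
have mrt x : measurable_fun setT (fun t => (r (x, t) * P t)%:E).
  apply/measurable_EFinP; apply: measurable_funM => //.
  exact: measurable_section_snd.
transitivity (\int[m1]_x \int[m2]_t (r (x, t) * W x * P t)%:E).
  apply: ae_eq_integral => //.
  - apply/measurable_EFinP; apply: measurable_funM => //.
    apply: measurableT_comp => //.
    apply: (measurable_integral_sndT (f := fun z => (r z * P z.2)%:E)).
    by apply/measurable_EFinP; apply: measurable_funM => //; exact: measurableT_comp.
  - exact: (measurable_integral_sndT (measurable_weighted mr)).
  apply: filterS irt => x irx _.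
  have [->|Wx0] := eqVneq (W x) 0%R.
    rewrite mulr0; apply/esym/integral0_eq => t _.
    by rewrite mulr0 mul0r.
  have {}irx := irx Wx0.
  transitivity (\int[m2]_t ((W x)%:E * (r (x, t) * P t)%:E)); last first.
    by apply: eq_integral => t _; rewrite -EFinM mulrCA mulrA.
  rewrite integralZl// [RHS]muleC EFinM /Rintegral fineK//.
  exact: integrable_fin_num irx.
rewrite (Fubini ir).
under eq_integral do under eq_integral do rewrite /= EFinM muleC.
rewrite -[RHS](integral0 m2 setT); apply: ae_eq_integral => //.
  under eq_fun do under eq_integral do rewrite muleC -EFinM.
  exact: (measurable_integral_fstT (measurable_weighted mr)).
have := ae_integrable2 ir; apply: filterS2 r0 => t rt irx _.
have [Pt|Pt0] := eqVneq (P t) 0%R.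
  by apply: integral0_eq => x _; rewrite Pt mul0e.
rewrite integralZl//; first by rewrite rt// mule0.
have := integrableZl measurableT (P t)^-1 irx; apply: eq_integrable => // x _.
by rewrite /= -EFinM mulrC mulfK.
Qed.

Variables (h : X * T -> R[i]) (L : R).
Hypothesis L_ge0 : (0 <= L)%R.
Hypothesis mh : cmeasurable_fun setT h.
Hypothesis IP : m2.-integrable setT (EFin \o P).
Hypothesis hL : {ae m2, forall t, P t != 0%R ->
  \int[m1]_x (Normc.normc (h (x, t)) * W x)%:E <= L%:E}.
Hypothesis h0 : {ae m2, forall t, P t != 0%R ->
  cintegral m1 setT (fun x => (h (x, t) * (W x)%:C)%R) = 0%R}.

Let G x := cintegral m2 setT (fun t => (h (x, t) * (P t)%:C)%R).
Let N := fun z : X * T => (Normc.normc (h z) * W z.1 * P z.2)%:E.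

Let mN : measurable_fun setT N.
Proof. by apply: measurable_weighted; exact: measurable_normc. Qed.

Let N_ge0 z : 0 <= N z.
Proof. by rewrite lee_fin !mulr_ge0// normc_ge0. Qed.

Let mnW t : measurable_fun setT (fun x => (Normc.normc (h (x, t)) * W x)%:E).
Proof.
apply/measurable_EFinP; apply: measurable_funM => //.
by apply: (measurable_section_fst (f := fun z => Normc.normc (h z))); exact: measurable_normc.
Qed.

(** Tonelli's theorem; the finiteness of the right-hand side gives the joint
    integrability on which the remaining lemmas rest. *)
Lemma integral_modulus_le :
  \int[m1]_x \int[m2]_t (Normc.normc (h (x, t)) * W x * P t)%:E <=
  L%:E * \int[m2]_t (P t)%:E.
Proof.
rewrite (fubini_tonelli N)//.
rewrite -ge0_integralZl//;
  [|exact/measurable_EFinP|by move=> t _; rewrite lee_fin].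
apply: ae_ge0_le_integral => //.
- by move=> t _; exact: integral_ge0.
- exact: (measurable_integral_fstT mN).
- by move=> t _; rewrite mule_ge0 ?lee_fin.
- by apply: measurable_funeM; exact/measurable_EFinP.
apply: filterS hL => t hLt _.
have [Pt|Pt0] := eqVneq (P t) 0%R.
  by rewrite Pt mule0 integral0_eq// => x _; rewrite /N /= Pt mulr0.
rewrite /N /=; under eq_integral do rewrite EFinM.
rewrite ge0_integralZr//; [|by move=> x _; rewrite lee_fin mulr_ge0// normc_ge0
  |by rewrite lee_fin].
by apply: lee_wpmul2r; rewrite ?lee_fin// hLt.
Qed.

Let iN : (m1 \x m2).-integrable setT N.
Proof.
apply/integrable12ltyP => //.
under eq_integral do under eq_integral do rewrite gee0_abs//.
apply: le_lt_trans integral_modulus_le _.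
rewrite lte_mul_pinfty// ?lee_fin//.
by have /integrableP[_] := IP; under eq_integral do rewrite gee0_abs ?lee_fin//.
Qed.

Let mhx x : cmeasurable_fun setT (fun t => h (x, t)).
Proof.
by case: mh => hr hi; split;
  [exact: (measurable_section_snd (f := fun z => complex.Re (h z)))
  |exact: (measurable_section_snd (f := fun z => complex.Im (h z)))].
Qed.

(** Where W x != 0 it can be divided out of the section at x of the jointly
    integrable function |h| W P. *)
Lemma ae_cintegrable_section : {ae m1, forall x, W x != 0%R ->
  cintegrable m2 setT (fun t => (h (x, t) * (P t)%:C)%R)}.
Proof.
have := ae_integrable1 iN; apply: filterS => x iNx Wx0.
have Wx : (0 < W x)%R by rewrite lt_neqAle eq_sym Wx0 W_ge0.
apply/cintegrableP => //; split; first exact: cmeasurable_funMr.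
have /integrableP[_] : m2.-integrable setT
    (fun t => ((W x)^-1 * (Normc.normc (h (x, t)) * W x * P t))%:E).
  by have := integrableZl measurableT (W x)^-1 iNx.
apply: le_lt_trans; rewrite le_eqVlt; apply/orP; left; apply/eqP.
apply: eq_integral => t _; rewrite /= Normc.normcM normc_real ger0_norm//.
rewrite ger0_norm ?mulr_ge0 ?invr_ge0 ?normc_ge0//; congr EFin.
by field.
Qed.

Lemma cmeasurable_average : cmeasurable_fun setT G.
Proof.
case: (cmeasurable_funMr (f := h) (h := fun z => P z.2) mh _) => [|hr hi].
  exact: measurableT_comp.
split; apply: (measurableT_comp (f := fine)) => //=.
  by apply: (measurable_integral_sndT
    (f := fun z => (complex.Re (h z * (P z.2)%:C))%:E)); exact/measurable_EFinP.
by apply: (measurable_integral_sndT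
  (f := fun z => (complex.Im (h z * (P z.2)%:C))%:E)); exact/measurable_EFinP.
Qed.

(** Minkowski's inequality for integrals, in weighted L^1. *)
Lemma integral_average_le :
  \int[m1]_x (Normc.normc (G x) * W x)%:E <= L%:E * \int[m2]_t (P t)%:E.
Proof.
apply: le_trans integral_modulus_le; apply: ae_ge0_le_integral => //.
- by move=> x _; rewrite lee_fin mulr_ge0// normc_ge0.
- apply/measurable_EFinP; apply: measurable_funM => //.
  by apply: measurable_normc; exact: cmeasurable_average.
- by move=> x _; apply: integral_ge0 => t _; exact: (N_ge0 (x, t)).
- exact: (measurable_integral_sndT mN).
apply: filterS ae_cintegrable_section => x icx _.
have [Wx|Wx0] := eqVneq (W x) 0%R.
  rewrite [leLHS](_ : _ = 0); last by rewrite Wx mulr0.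
  by apply: integral_ge0 => t _; exact: (N_ge0 (x, t)).
have {}icx := icx Wx0; have [mx _] := (cintegrableP _ _ measurableT).1 icx.
rewrite [leRHS](_ : _ = (W x)%:E *
    \int[m2]_t (Normc.normc (h (x, t) * (P t)%:C)%R)%:E).
  rewrite EFinM muleC; apply: lee_wpmul2l; first by rewrite lee_fin.
  exact: normc_cintegral_le.
rewrite -ge0_integralZl//; [|by apply/measurable_EFinP; exact: measurable_normc
  |by move=> t _; rewrite lee_fin normc_ge0|by rewrite lee_fin].
apply: eq_integral => t _; rewrite -EFinM Normc.normcM normc_real ger0_norm//.
by congr EFin; ring.
Qed.

Lemma cintegrable_average : cintegrable m1 setT (fun x => (G x * (W x)%:C)%R).
Proof.
apply/cintegrableP => //; split.
  by apply: cmeasurable_funMr => //; exact: cmeasurable_average.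
under eq_integral do rewrite Normc.normcM normc_real ger0_norm//.
apply: le_lt_trans integral_average_le _.
rewrite lte_mul_pinfty// ?lee_fin//.
by have /integrableP[_] := IP; under eq_integral do rewrite gee0_abs ?lee_fin//.
Qed.

Let iW (r : X * T -> R) : measurable_fun setT r ->
  (forall z, `|r z| <= Normc.normc (h z))%R ->
  (m1 \x m2).-integrable setT (fun z => (r z * W z.1 * P z.2)%:E).
Proof.
move=> mr rh; apply: le_integrable iN => //; first exact: measurable_weighted.
move=> z _; rewrite /N /= lee_fin !normrM ler_wpM2r// ler_wpM2r//.
by rewrite (le_trans (rh z))// ler_norm.
Qed.

Let itW : {ae m2, forall t, P t != 0%R ->
  cintegrable m1 setT (fun x => (h (x, t) * (W x)%:C)%R)}.
Proof.
apply: filterS hL => t ht Pt0; apply/cintegrableP => //; split.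
  apply: cmeasurable_funMr => //; case: mh => hr hi; split.
    exact: (measurable_section_fst (f := fun z => complex.Re (h z))).
  exact: (measurable_section_fst (f := fun z => complex.Im (h z))).
under eq_integral do rewrite Normc.normcM normc_real ger0_norm//.
by apply: le_lt_trans (ht Pt0) _; rewrite ltry.
Qed.

Lemma cintegral_average0 : cintegral m1 setT (fun x => (G x * (W x)%:C)%R) = 0%R.
Proof.
case: (mh) => hr hi; apply: complexP.
- change (fine (\int[m1]_x (complex.Re (G x * (W x)%:C)%R)%:E) = 0%R).
  under eq_integral do rewrite cReMr.
  transitivity (fine (\int[m1]_x
      ((\int[m2]_t (complex.Re (h (x, t)) * P t))%R * W x)%:E)).
    apply: (congr1 fine); apply: eq_integral => x _; rewrite -[complex.Re (G x)]/(
      \int[m2]_t complex.Re (h (x, t) * (P t)%:C))%R.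
    by under eq_Rintegral do rewrite cReMr.
  rewrite (integral_weighted_average0 (r := fun z => complex.Re (h z)))//.
  + by apply: iW => // z; exact: ler_normc_Re.
  + apply: filterS2 h0 itW => t ht it Pt0; have [ir _] := it Pt0.
    have h1 : (\int[m1]_x complex.Re (h (x, t) * (W x)%:C))%R = 0%R.
      exact: (congr1 (@complex.Re R) (ht Pt0)).
    have := congr1 EFin h1; rewrite /Rintegral fineK; last exact: integrable_fin_num.
    by move=> h2; apply: etrans h2; apply: eq_integral => x _; rewrite cReMr.
  + apply: filterS ae_cintegrable_section => x + Wx0 => /(_ Wx0)[+ _].
    by apply: eq_integrable => // t _; rewrite cReMr.
- change (fine (\int[m1]_x (complex.Im (G x * (W x)%:C)%R)%:E) = 0%R).
  under eq_integral do rewrite cImMr.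
  transitivity (fine (\int[m1]_x
      ((\int[m2]_t (complex.Im (h (x, t)) * P t))%R * W x)%:E)).
    apply: (congr1 fine); apply: eq_integral => x _; rewrite -[complex.Im (G x)]/(
      \int[m2]_t complex.Im (h (x, t) * (P t)%:C))%R.
    by under eq_Rintegral do rewrite cImMr.
  rewrite (integral_weighted_average0 (r := fun z => complex.Im (h z)))//.
  + by apply: iW => // z; exact: ler_normc_Im.
  + apply: filterS2 h0 itW => t ht it Pt0; have [_ ir] := it Pt0.
    have h1 : (\int[m1]_x complex.Im (h (x, t) * (W x)%:C))%R = 0%R.
      exact: (congr1 (@complex.Im R) (ht Pt0)).
    have := congr1 EFin h1; rewrite /Rintegral fineK; last exact: integrable_fin_num.
    by move=> h2; apply: etrans h2; apply: eq_integral => x _; rewrite cImMr.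
  + apply: filterS ae_cintegrable_section => x + Wx0 => /(_ Wx0)[_].
    by apply: eq_integrable => // t _; rewrite cImMr.
Qed.

End fubini_averages.

(** * Euclidean balls *)

Section balls.
Context (R : realType) (n : nat).
Local Notation mR := (measurableTypeR R).
Implicit Types (x c : n.-tuple R) (s r : R).

Definition zerov : n.-tuple R := [tuple 0 | _ < n].

Lemma tnth_scalev s x i : tnth (scalev s x) i = s * tnth x i.
Proof. by rewrite tnth_mktuple. Qed.

Lemma normv_ge0 x : 0 <= normv x.
Proof. exact: sqrtr_ge0. Qed.

Lemma normv_scalev s x : normv (scalev s x) = `|s| * normv x.
Proof.
rewrite /normv; under eq_bigr do rewrite tnth_scalev exprMn.
by rewrite -mulr_sumr sqrtrM ?sqr_ge0// sqrtr_sqr.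
Qed.

Lemma scalevA s r x : scalev s (scalev r x) = scalev (s * r) x.
Proof. by apply: eq_from_tnth => i; rewrite !tnth_scalev mulrA. Qed.

Lemma scale1v x : scalev 1 x = x.
Proof. by apply: eq_from_tnth => i; rewrite tnth_scalev mul1r. Qed.

Lemma scalevB s x c : subv (scalev s x) (scalev s c) = scalev s (subv x c).
Proof. by apply: eq_from_tnth => i; rewrite !tnth_mktuple mulrBr. Qed.

Lemma scalev_zerov s : scalev s zerov = zerov.
Proof. by apply: eq_from_tnth => i; rewrite !tnth_mktuple mulr0. Qed.

Lemma normv_eq0 x : normv x = 0 -> x = zerov.
Proof.
move/eqP; rewrite sqrtr_eq0 => x0; apply: eq_from_tnth => i; rewrite tnth_mktuple.
apply/eqP; rewrite -sqrf_eq0 eq_le sqr_ge0 andbT (le_trans _ x0)//.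
by rewrite (bigD1 i)//= lerDl sumr_ge0// => j _; exact: sqr_ge0.
Qed.

Lemma preimage_scalev_ballv s c r : s != 0 ->
  scalev s @^-1` ballv (scalev s c) (`|s| * r) = ballv c r.
Proof.
move=> s0; apply/seteqP; split=> x /=;
by rewrite /ballv /= scalevB normv_scalev ltr_pM2l// normr_gt0.
Qed.

Lemma ballv_zerov r : ballv zerov r = [set x | normv x < r].
Proof.
apply/seteqP; split=> x; rewrite /ballv /= (_ : subv x zerov = x)//;
by apply: eq_from_tnth => i; rewrite !tnth_mktuple subr0.
Qed.

(** Stands in for the triangle inequality: |x|^2 <= 2 |x - c|^2 + 2 |c|^2 holds
    coordinatewise. *)
Lemma subset_ballv_zerov c r : exists2 M, 0 < M & ballv c r `<=` ballv zerov M.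
Proof.
pose M2 := 2 * r ^+ 2 + 2 * \sum_(i < n) tnth c i ^+ 2.
have M2_ge0 : 0 <= M2.
  by rewrite addr_ge0// mulr_ge0// ?sqr_ge0// sumr_ge0// => i _; exact: sqr_ge0.
exists (Num.sqrt M2 + 1); first by rewrite ltr_wpDl// sqrtr_ge0.
rewrite ballv_zerov => x /=; rewrite /ballv /= => xr.
rewrite (@le_lt_trans _ _ (Num.sqrt M2)) ?ltrDl//.
rewrite ler_wsqrtr//.
have r_ge0 : 0 <= r by rewrite (le_trans (normv_ge0 (subv x c)))// ltW.
have : \sum_(i < n) tnth (subv x c) i ^+ 2 <= r ^+ 2.
  rewrite -(sqr_sqrtr (sumr_ge0 _ (fun i _ => sqr_ge0 (tnth (subv x c) i)))).
  by rewrite ler_pXn2r ?nnegrE ?sqrtr_ge0// ltW.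
rewrite /M2 => xcr; apply: le_trans (lerD (ler_wpM2l (ler0n R 2) xcr) (lexx _)).
rewrite !mulr_sumr -big_split/=; apply: ler_sum => i _; rewrite tnth_mktuple.
have : 0 <= (tnth x i - 2 * tnth c i) ^+ 2 by exact: sqr_ge0.
nra.
Qed.

Lemma measurable_ballv c r : measurable (ballv c r : set (Rn R n)).
Proof.
apply: measurable_Rn.
have ms : measurable_fun [set: n.-tuple mR] (fun x => subv x c : n.-tuple mR).
  apply/measurable_fun_tnthP => i.
  rewrite (_ : _ \o _ = (fun y : mR => y - tnth c i : mR) \o
    (fun x : n.-tuple mR => tnth x i)).
    apply: measurableT_comp; last exact: measurable_tnth.
    by apply: measurable_funB => //; exact: measurable_cst.
  by apply/funext => x /=; rewrite tnth_mktuple.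
rewrite (_ : ballv c r = setT `&` (@normv R n \o (fun x => subv x c)) @^-1` `]-oo, r[).
  apply: measurableT_comp => //; first exact: measurable_normv.
by rewrite setTI; apply/seteqP; split=> x /=; rewrite in_itv.
Qed.

(** A point of the cube has |x|^2 <= n < (n + 1)^2. *)
Lemma boxv_sub_ballv (a b : 'I_n -> R) :
  (forall i, -1 <= a i) -> (forall i, b i <= 1) ->
  boxv a b `<=` ballv zerov n.+1%:R.
Proof.
move=> a1 b1 x bx; rewrite ballv_zerov /= /normv.
rewrite -(ger0_norm (ler0n R n.+1)) -sqrtr_sqr ltr_sqrt; last first.
  by rewrite exprn_gt0.
apply: (@le_lt_trans _ _ (\sum_(i < n) 1)).
  apply: ler_sum => i _; have /andP[ax xb] := bx i.
  have := a1 i; have := b1 i; nra.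
rewrite sumr_const card_ord -natrX ltr_nat.
by rewrite (leq_trans (ltnSn n))// leq_pmulr.
Qed.

Lemma lebesgue_Rn_boxv_gt0 (a b : 'I_n -> R) : (forall i, a i < b i) ->
  (0 < lebesgue_Rn R n (boxv a b))%E.
Proof.
move=> ab; rewrite lebesgue_RnE; last exact: measurable_boxv.
rewrite borel_lebesgue_box => [|i]; last exact: ltW.
by rewrite lte_fin prodr_gt0// => i _; rewrite subr_gt0.
Qed.

(** The origin is its own preimage under the dilation by 2, and taking the
    preimage divides measures by 2 ^ n. *)
Lemma lebesgue_Rn_zerov : (0 < n)%N -> lebesgue_Rn R n [set zerov] = 0%E.
Proof.
move=> n0; pose b k : set (n.-tuple R) := boxv (fun=> - k) (fun=> k : R).
have b0 (k : R) : 0 < k -> [set zerov] `<=` b k.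
  by move=> k0 _ -> i; rewrite tnth_mktuple oppr_lt0 k0.
have mZ : measurable ([set zerov] : set (n.-tuple mR)).
  rewrite (_ : [set zerov] = setT `&` @normv R n @^-1` [set 0]).
    by apply: measurable_normv => //.
  rewrite setTI; apply/seteqP; split=> x /=; last exact: normv_eq0.
  move=> ->; rewrite /normv big1 ?sqrtr0// => i _.
  by rewrite tnth_mktuple expr0n.
have fZ : (lebesgue_Rn R n [set zerov] < +oo)%E.
  rewrite (@le_lt_trans _ _ (lebesgue_Rn R n (b 1)))//.
    by apply: le_measure; rewrite ?inE; [exact: measurable_Rn|
      apply: measurable_Rn; exact: measurable_boxv|exact: b0].
  rewrite lebesgue_RnE; last exact: measurable_boxv.
  by rewrite borel_lebesgue_box ?ltry// => i; rewrite ge0_cp.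
have := @lebesgue_Rn_dilation R n 2 [set zerov] (lt0r_neq0 (ltr0Sn R 1)) (measurable_Rn mZ).
rewrite (_ : _ @^-1` _ = [set zerov]); last first.
  apply/seteqP; split=> x /=; last by move=> ->; rewrite scalev_zerov.
  by move=> /(congr1 (scalev 2^-1)); rewrite scalevA mulVf// scale1v scalev_zerov.
have : (0 <= lebesgue_Rn R n [set zerov])%E by exact: measure_ge0.
case: (lebesgue_Rn R n [set zerov]) fZ => [z||]// _; rewrite lee_fin => z0.
rewrite -EFinM => -[] /eqP; rewrite -subr_eq0 -{1}(mul1r z) -mulrBl mulf_eq0.
case/orP => [|/eqP -> //]; rewrite subr_eq0 normr_nat -exprVn eq_sym.
move=> /eqP h; suff : (2^-1 : R) ^+ n < 1 by rewrite h ltxx.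
by rewrite exprn_ilt1 -?lt0n// ?invf_lt1// ?invr_ge0// ltr1n.
Qed.

End balls.

(** * Mass of a weight on balls *)

Section weight_mass.
Context (R : realType) (n : nat).
Hypothesis n_gt0 : (0 < n)%N.
Local Notation mu := (lebesgue_Rn R n).
Local Open Scope ereal_scope.

Variable w : n.-tuple R -> R.
Variable alpha : R.
Hypothesis alpha_gt : (- n%:R < alpha)%R.
Hypothesis w_class : weight_class alpha w.

(* with the positive part all integrands below are nonnegative *)
Let v := fun x => Num.max (w x) 0%R.

Let w_hom (t : R) x : t != 0%R -> w (scalev t x) = (`|t| `^ alpha * w x)%R.
Proof. by case: w_class => _ _ _; apply. Qed.

Let v_hom (t : R) x : t != 0%R -> v (scalev t x) = (`|t| `^ alpha * v x)%R.
Proof.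
by move=> t0; rewrite /v w_hom// maxr_pMr ?powR_ge0// mulr0.
Qed.

Let mw : measurable_fun [set: Rn R n] w.
Proof. by case: w_class. Qed.

Let mv : measurable_fun [set: Rn R n] v.
Proof. by apply: measurable_maxr => //; exact: measurable_cst. Qed.

Let v_ge0 x : (0 <= v x)%R.
Proof. by rewrite le_max lexx orbT. Qed.

Let mnormv : measurable_fun [set: Rn R n] (@normv R n).
Proof. exact: measurable_normv_Rn. Qed.

Let mpunct := @measurable_punctured_ballv R n.

Let w_normalize x : (0 < normv x)%R ->
  w (normalizev x) = (normv x `^ (- alpha) * w x)%R.
Proof.
move=> x0; rewrite /normalizev w_hom ?invr_neq0 ?gt_eqF// gtr0_norm ?invr_gt0//.
by rewrite powRN -powR_inv1 ?normv_ge0// -powRrM mulN1r powRN.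
Qed.

Let measurable_spherev : measurable (@spherev R n : set (sphere_space R n)).
Proof.
apply: sub_sigma_algebra; rewrite /image_set_system /= setTI.
rewrite (_ : _ @^-1` _ = setT `&` (@normv R n @^-1` `]0%R, +oo[)).
  exact: mnormv.
rewrite setTI; apply/seteqP; split=> x; rewrite /spherev /= in_itv/= andbT.
  move=> nx; rewrite lt_neqAle normv_ge0 andbT; apply/eqP => x0.
  by move: nx; rewrite /normalizev normv_scalev -x0 mulr0 => /esym/eqP; rewrite oner_eq0.
move=> x0; rewrite /normalizev normv_scalev gtr0_norm ?invr_gt0// mulVf//.
by rewrite gt_eqF.
Qed.

(* the cone over a preimage on the sphere is a preimage under the 0-homogeneous
   extension of w *)
Let measurable_w_sphere :
  measurable_fun (@spherev R n : set (sphere_space R n)) w.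
Proof.
move=> _ B mB; apply: sub_sigma_algebra; rewrite /image_set_system /= setTI.
have mg : measurable_fun [set: Rn R n] (fun x => normv x `^ (- alpha) * w x)%R.
  apply: measurable_funM; last exact: mw.
  exact: (measurableT_comp (measurable_powR (- alpha)%R) mnormv).
rewrite (_ : _ @^-1` _ = (setT `&` (@normv R n @^-1` `]0%R, +oo[)) `&`
    (setT `&` (fun x => normv x `^ (- alpha) * w x)%R @^-1` B)).
  by apply: measurableI; [exact: mnormv|exact: mg].
rewrite !setTI; apply/seteqP; split=> x; rewrite /spherev /= in_itv/= andbT.
  move=> [nx wB]; have x0 : (0 < normv x)%R.
    rewrite lt_neqAle normv_ge0 andbT; apply/eqP => x0.
    move: nx; rewrite /normalizev normv_scalev -x0 mulr0 => /esym/eqP.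
    by rewrite oner_eq0.
  by split => //; rewrite -w_normalize.
move=> [x0]; rewrite -w_normalize// => wB; split => //.
rewrite /normalizev normv_scalev gtr0_norm ?invr_gt0// mulVf//.
by rewrite gt_eqF.
Qed.

Let measurable_v_sphere :
  measurable_fun (@spherev R n : set (sphere_space R n)) v.
Proof. by apply: measurable_maxr => //; exact: measurable_cst. Qed.

(* the surface integral of w is that of v minus a nonnegative term, and it is
   positive and finite; if that of v were +oo, the difference would be +oo or
   -oo *)
Let sphere_lty : \int[surface_measure R n]_(y in @spherev R n) (v y)%:E < +oo.
Proof.
have [_ _ /andP[s0 soo] _] := w_class.
have [A [B [wAB vA]]] : exists A B,
    \int[surface_measure R n]_(y in @spherev R n) (w y)%:E = A - B /\
    \int[surface_measure R n]_(y in @spherev R n) (v y)%:E = A.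
  rewrite integralE; eexists; eexists; split; first by [].
  by apply: eq_integral => y _; rewrite funeposE /v -EFin_max.
move: s0 soo; rewrite wAB vA; case: A {wAB vA} => [r||]; last by [].
  by rewrite ltry.
by case: B.
Qed.

(* surface measure is n times the image of Lebesgue measure on the punctured
   ball under the radial projection *)
Let punct_lty : \int[mu]_(x in @punctured_ballv R n) (v (normalizev x))%:E < +oo.
Proof.
pose S := @normalizev R n @^-1` @spherev R n.
have mS : measurable (S : set (Rn R n)).
  by rewrite -[X in measurable X]setTI; exact: measurable_normalizev.
have PS : @punctured_ballv R n `<=` S.
  move=> x /andP[x0 _]; rewrite /S /spherev /= /normalizev normv_scalev.
  by rewrite gtr0_norm ?invr_gt0// mulVf// gt_eqF.
have msv : measurable_fun (S : set (Rn R n)) (fun x => (v (normalizev x))%:E).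
  apply/measurable_EFinP; apply: (measurable_comp measurable_spherev) => //.
    by move=> _ [x Sx <-].
  by apply: measurable_funTS; exact: measurable_normalizev.
have nV0 : (0 <= n%:R^-1 :> R)%R by rewrite invr_ge0.
have := @ge0_integral_change _ _ _ _ _ (mrestr mu mpunct) (surface_measure R n)
  (@normalizev R n) n%:R^-1 (@measurable_normalizev R n) nV0 _
  (@spherev R n) (fun y => (v y)%:E) measurable_spherev.
rewrite -/S => E.
have {E} : \int[mrestr mu mpunct]_(x in S) (v (normalizev x))%:E < +oo.
  rewrite E//.
  - by rewrite lte_mul_pinfty// lee_fin.
  - move=> A mA; rewrite /surface_measure muleA -EFinM mulVf ?mul1e.
      by rewrite /mrestr setIC.
    by rewrite pnatr_eq0 -lt0n.
  - exact/measurable_EFinP.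
  - by move=> y _; rewrite lee_fin.
apply: le_lt_trans.
rewrite (@ge0_negligible_integral _ _ _ (mrestr mu mpunct) S
  (S `\` @punctured_ballv R n) (fun x => (v (normalizev x))%:E)); first last.
- change (mu ((S `\` @punctured_ballv R n) `&` @punctured_ballv R n) = 0).
  by rewrite setDE -setIA setICl setI0 measure0.
- by move=> x _; rewrite lee_fin.
- exact: msv.
- exact: mS.
- exact: measurableD.
have -> : S `\` (S `\` @punctured_ballv R n) = @punctured_ballv R n.
  by rewrite setDD setIidr.
rewrite le_eqVlt; apply/orP; left; apply/eqP.
by apply: eq_measure_integral => A mA AP; exact: (congr1 mu (esym (setIidl AP))).
Qed.

Let annulus (k : nat) : set (Rn R n) := [set x | (2 ^- k <= normv x < 1)%R].

Let measurable_annulus k : measurable (annulus k).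
Proof.
rewrite (_ : annulus k = setT `&` @normv R n @^-1` `[(2 ^- k)%R, 1%R[).
  exact: mnormv.
by rewrite setTI; apply/seteqP; split=> x; rewrite /annulus /= in_itv.
Qed.

Let v_meas_E (D : set (Rn R n)) : measurable_fun D (fun x => (v x)%:E).
Proof. by apply/measurable_EFinP; exact: measurable_funTS. Qed.

(* on the annulus of radii 1/2 and 1 the factor normv x `^ alpha is bounded *)
Let annulus1_lty : \int[mu]_(x in annulus 1) (v x)%:E < +oo.
Proof.
pose C := (2 `^ `|alpha|)%R.
have C0 : (0 <= C)%R by exact: powR_ge0.
have E0 x : annulus 1 x -> (0 < normv x)%R.
  by move=> /andP[x1 _]; rewrite (lt_le_trans _ x1)// invr_gt0 exprn_gt0.
have mvn : measurable_fun (@punctured_ballv R n) (fun x => (v (normalizev x))%:E).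
  apply/measurable_EFinP.
  apply: (measurable_comp measurable_spherev) => //.
    move=> _ [x /andP[x0 _] <-]; rewrite /spherev /= /normalizev normv_scalev.
    by rewrite gtr0_norm ?invr_gt0// mulVf// gt_eqF.
  by apply: measurable_funTS; exact: measurable_normalizev.
have EP : annulus 1 `<=` @punctured_ballv R n.
  by move=> x Ex; have x0 := E0 x Ex; case/andP: Ex => _ x1; apply/andP.
apply: (@le_lt_trans _ _ (C%:E * \int[mu]_(x in @punctured_ballv R n)
    (v (normalizev x))%:E)); last by rewrite lte_mul_pinfty// lee_fin.
rewrite -ge0_integralZl//; last by move=> x _; rewrite lee_fin.
apply: (@le_trans _ _ (\int[mu]_(x in annulus 1) (C%:E * (v (normalizev x))%:E))).
  apply: ge0_le_integral.
  - exact: measurable_annulus.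
  - by move=> x _; rewrite lee_fin.
  - exact: v_meas_E.
  - apply: measurable_funeM; exact: measurable_funS mvn.
  move=> x Ex; have x0 := E0 x Ex; rewrite -EFinM lee_fin.
  have vx : v x = (normv x `^ alpha * v (normalizev x))%R.
    rewrite /normalizev v_hom ?invr_neq0 ?gt_eqF// mulrA gtr0_norm ?invr_gt0//.
    by rewrite -powRM ?invr_ge0 ?normv_ge0// mulfV ?gt_eqF// powR1 mul1r.
  rewrite vx ler_wpM2r//.
  case/andP: Ex; rewrite expr1 => x1 x2.
  have [a0|a0] := leP 0%R alpha.
    apply: (@le_trans _ _ 1%R).
      have -> : (1 = 1 `^ alpha)%R by rewrite powR1.
      by apply: ge0_ler_powR; rewrite ?nnegrE ?normv_ge0// ltW.
    have := @ler_powR R 2 (ler1n R 2) _ _ (normr_ge0 alpha).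
    by rewrite powRr0.
  rewrite /C ltr0_norm//.
  have -> : (normv x `^ alpha = (normv x)^-1 `^ (- alpha))%R.
    by rewrite -powR_inv1 ?normv_ge0// -powRrM mulN1r opprK.
  apply: ge0_ler_powR; rewrite ?nnegrE ?invr_ge0 ?normv_ge0//.
    by rewrite oppr_ge0 ltW.
  by rewrite -[leRHS]invrK lef_pV2// posrE invr_gt0.
apply: ge0_subset_integral.
- exact: measurable_annulus.
- exact: mpunct.
- exact: measurable_funeM.
- by move=> x _; rewrite -EFinM lee_fin mulr_ge0.
- exact: EP.
Qed.

(* the factor by which the dilation by 1/2 multiplies masses; it is less than 1
   because alpha > - n *)
Let q : R := (2 `^ (- alpha) * 2 ^- n)%R.

Let q_lt1 : (q < 1)%R.
Proof.
rewrite /q -powR_invn// -powRD; last by rewrite pnatr_eq0 implybT.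
rewrite -opprD powRN invf_lt1 ?powR_gt0// /powR pnatr_eq0 /=.
rewrite expR_gt1 mulr_gt0//; last by rewrite ln_gt0// ltr1n.
by rewrite -ltrBlDr sub0r.
Qed.

Let q_ge0 : (0 <= q)%R.
Proof. by rewrite mulr_ge0 ?powR_ge0// invr_ge0 exprn_ge0. Qed.

(* annulus k.+1 is the union of annulus 1 and of its part of radii less than
   1/2, which the dilation by 2 maps onto annulus k *)
Let annulusS k : \int[mu]_(x in annulus k.+1) (v x)%:E =
  \int[mu]_(x in annulus 1) (v x)%:E + q%:E * \int[mu]_(x in annulus k) (v x)%:E.
Proof.
have n2 : (2 : R)%R != 0%R by rewrite pnatr_eq0.
have E2 : scalev (2 : R)%R @^-1` annulus k = [set x | (2 ^- k.+1 <= normv x < 2^-1)%R].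
  apply/seteqP; split=> x; rewrite /annulus /= normv_scalev normr_nat exprS invfM.
    by move=> /andP[x1 x2]; apply/andP; split; lra.
  by move=> /andP[x1 x2]; apply/andP; split; lra.
have mE2 : measurable (scalev (2 : R)%R @^-1` annulus k : set (Rn R n)).
  by rewrite -[X in measurable X]setTI; exact: measurable_scalev_Rn.
rewrite (_ : annulus k.+1 = annulus 1 `|` scalev (2 : R)%R @^-1` annulus k); last first.
  rewrite E2; apply/seteqP; split=> x; rewrite /annulus /= expr1.
    move=> /andP[x1 x2]; have [h|h] := leP (2^-1)%R (normv x); [left|right].
      by rewrite x2.
    by rewrite x1.
  case=> /andP[x1 x2]; rewrite ?x1 ?x2 /=.
    rewrite andbT (le_trans _ x1)// lef_pV2 ?posrE ?exprn_gt0//.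
    by rewrite -{1}(expr1 2%R) ler_weXn2l// ler1n.
  by rewrite (lt_trans x2)// invf_lt1// ltr1n.
rewrite ge0_integral_setU//; last 2 first.
- by move=> x _; rewrite lee_fin.
- apply/disj_setPS; rewrite E2 => x [/andP[+ _] /andP[_ x2]].
  by rewrite expr1 leNgt x2.
congr (_ + _).
have sc0 : (0 <= `|2 : R| ^- n)%R by rewrite invr_ge0 exprn_ge0.
have E : \int[mu]_(x in scalev (2 : R)%R @^-1` annulus k) (v (scalev 2%R x))%:E =
    (`|2 : R| ^- n)%:E * \int[mu]_(x in annulus k) (v x)%:E.
  apply: (ge0_integral_change (measurable_scalev_Rn n2) sc0
    (fun A mA => lebesgue_Rn_dilation n2 mA) (measurable_annulus k)
    (f := fun x => (v x)%:E)); first exact: v_meas_E.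
  by move=> x _; rewrite lee_fin.
have q2 : q%:E = (2 `^ (- alpha))%:E * (`|2 : R| ^- n)%:E.
  by rewrite -EFinM normr_nat.
have mv2 : measurable_fun (scalev (2 : R)%R @^-1` annulus k : set (Rn R n))
    (fun x => (v (scalev 2%R x))%:E).
  apply/measurable_EFinP; apply: measurable_funTS.
  exact: (measurableT_comp mv (measurable_scalev_Rn n2)).
have v2_ge0 x : (scalev (2 : R)%R @^-1` annulus k) x -> 0 <= (v (scalev 2%R x))%:E.
  by move=> _; rewrite lee_fin.
have a2_ge0 : 0 <= (2 `^ (- alpha))%:E by rewrite lee_fin powR_ge0.
rewrite q2 -muleA -E -(ge0_integralZl mu mE2 mv2 v2_ge0 a2_ge0).
apply: eq_integral => x _; rewrite v_hom// -EFinM mulrA normr_nat.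
by rewrite -powRD ?addNr ?powRr0 ?mul1r// eqxx n2.
Qed.

(* the bound is the fixed point of a |-> mass of annulus 1 + q a *)
Let annulus_le k : \int[mu]_(x in annulus k) (v x)%:E <=
  (fine (\int[mu]_(x in annulus 1) (v x)%:E) / (1 - q))%:E.
Proof.
have q1 : (0 < 1 - q)%R by rewrite subr_gt0.
have afin : \int[mu]_(x in annulus 1) (v x)%:E \is a fin_num.
  by rewrite ge0_fin_numE// integral_ge0// => x _; rewrite lee_fin.
elim: k => [|k ih].
  rewrite (_ : annulus 0 = set0) ?integral_set0.
    rewrite lee_fin; apply: divr_ge0; last exact: ltW.
    by apply: fine_ge0; apply: integral_ge0 => x _; rewrite lee_fin.
  apply/seteqP; split=> // x /andP[]; rewrite expr0 invr1 => h1 h2.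
  by move: (le_lt_trans h1 h2); rewrite ltxx.
rewrite annulusS; set a := \int[mu]_(x in annulus 1) _ in afin ih *.
apply: (@le_trans _ _ (a + q%:E * (fine a / (1 - q))%:E)).
  by rewrite leeD2l// lee_wpmul2l// lee_fin.
rewrite -{1}(fineK afin) -EFinM -EFinD lee_fin le_eqVlt; apply/orP; left; apply/eqP.
by field; rewrite gt_eqF.
Qed.

Let unit_ball_lty : \int[mu]_(x in ballv (zerov R n) 1) (v x)%:E < +oo.
Proof.
have P_E : @punctured_ballv R n = \bigcup_k annulus k.
  apply/seteqP; split=> x; last first.
    move=> [k _ /andP[x1 x2]]; apply/andP; split => //.
    by rewrite (lt_le_trans _ x1)// invr_gt0 exprn_gt0.
  move=> /andP[x0 x1].
  have [k _ /(_ k (leqnn k)) xk] := near_infty_natSinv_expn_lt (PosNum x0).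
  exists k => //; apply/andP; split => //.
  by move: xk; rewrite /= div1r => /ltW.
have -> : ballv (zerov R n) 1 = @punctured_ballv R n `|` [set zerov R n].
  rewrite ballv_zerov; apply/seteqP; split=> x /=.
    move=> x1; have [x0|x0] := ltP 0%R (normv x); first by left; apply/andP.
    by right; apply: normv_eq0; apply/eqP; rewrite eq_le x0 normv_ge0.
  case=> [/andP[_ ->]//|->]; rewrite /normv big1 ?sqrtr0// => i _.
  by rewrite tnth_mktuple expr0n.
have m0 : measurable ([set zerov R n] : set (Rn R n)).
  apply: lebesgue_Rn_complete; exists (@normv R n @^-1` [set 0%R]); split.
  - by rewrite -[X in measurable X]setTI; exact: mnormv.
  - rewrite -[RHS](lebesgue_Rn_zerov R n_gt0); congr (mu _).
    apply/seteqP; split=> x /=; first exact: normv_eq0.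
    by move=> ->; rewrite /normv big1 ?sqrtr0// => i _; rewrite tnth_mktuple expr0n.
  - move=> _ ->; rewrite /= /normv big1 ?sqrtr0// => i _.
    by rewrite tnth_mktuple expr0n.
apply: (@le_lt_trans _ _ (\int[mu]_(x in @punctured_ballv R n) (v x)%:E)).
  have mU : measurable (@punctured_ballv R n `|` [set zerov R n] : set (Rn R n)).
    exact: measurableU mpunct m0.
  have v0 (D : set (Rn R n)) x : D x -> 0 <= (v x)%:E by rewrite lee_fin.
  rewrite [leLHS](ge0_negligible_integral m0 mU (@v_meas_E _) (@v0 _)
    (lebesgue_Rn_zerov R n_gt0)).
  apply: ge0_subset_integral; last by move=> x [[]].
  - exact: measurableD.
  - exact: mpunct.
  - exact: v_meas_E.
  - exact: v0.
rewrite P_E.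
have annulus_nd : nondecreasing_seq annulus.
  apply/nondecreasing_seqP => k; apply/subsetPset => x /andP[x1 x2].
  apply/andP; split => //; rewrite (le_trans _ x1)// lef_pV2 ?posrE ?exprn_gt0//.
  by rewrite ler_weXn2l// ler1n.
have v0 k x : annulus k x -> 0 <= (v x)%:E by rewrite lee_fin.
have vc := @ge0_nondecreasing_set_cvg_integral _ _ _ annulus (fun x => (v x)%:E) mu
  annulus_nd measurable_annulus (fun k => @v_meas_E (annulus k)) v0.
rewrite -(cvg_lim _ vc)//; apply: le_lt_trans (ltry _).
apply: lime_le; first by apply/cvg_ex; eexists; exact: vc.
by apply: nearW => k; exact: annulus_le.
Qed.

(** The annuli of outer radius 1 exhaust the unit ball up to its center, and
    their masses obey a contracting affine recursion, hence are bounded. Other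
    balls lie in dilates of the unit ball. *)
Lemma posweight_ball_lty c r : \int[mu]_(x in ballv c r) (v x)%:E < +oo.
Proof.
have [M M0 cM] := subset_ballv_zerov c r.
apply: (@le_lt_trans _ _ (\int[mu]_(x in ballv (zerov R n) M) (v x)%:E)).
  apply: ge0_subset_integral => //; first exact: measurable_ballv.
  - exact: measurable_ballv.
  - by move=> x _; rewrite lee_fin.
have nM : M^-1%R != 0%R by rewrite invr_neq0// gt_eqF.
have sc0 : (0 <= `|M^-1| ^- n)%R by rewrite invr_ge0 exprn_ge0.
have E : \int[mu]_(x in scalev M^-1 @^-1` ballv (zerov R n) 1) (v (scalev M^-1 x))%:E =
    (`|M^-1| ^- n)%:E * \int[mu]_(x in ballv (zerov R n) 1) (v x)%:E.
  apply: (ge0_integral_change (measurable_scalev_Rn nM) sc0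
    (fun A mA => lebesgue_Rn_dilation nM mA) (measurable_ballv _ _)
    (f := fun x => (v x)%:E)); first exact: v_meas_E.
  by move=> x _; rewrite lee_fin.
have : \int[mu]_(x in scalev M^-1 @^-1` ballv (zerov R n) 1) (v (scalev M^-1 x))%:E
    < +oo by rewrite E lte_mul_pinfty// lee_fin.
have -> : scalev M^-1 @^-1` ballv (zerov R n) 1 = ballv (zerov R n) M.
  have := @preimage_scalev_ballv R n M^-1 (zerov R n) M nM.
  by rewrite scalev_zerov normfV gtr0_norm// mulVf// gt_eqF.
have a0 : (0 < `|M^-1| `^ alpha)%R by rewrite powR_gt0// normr_gt0.
under eq_integral do rewrite v_hom// EFinM.
have v0 x : ballv (zerov R n) M x -> 0 <= (v x)%:E by rewrite lee_fin.
rewrite (ge0_integralZl mu (@measurable_ballv R n _ _) (@v_meas_E _) v0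
  (_ : 0 <= (`|M^-1| `^ alpha)%:E)); last by rewrite lee_fin ltW.
case: (\int[mu]_(x in _) _) => [s||].
- by rewrite !ltry.
- by rewrite gt0_muley ?lte_fin.
- by move=> _; exact: lt_trans (ltNyr 0%R) (ltry 0%R).
Qed.

End weight_mass.

(** * Dilation invariance of the mean oscillation *)

Section regular_weights.
Context (R : realType) (n : nat).
Local Notation mu := (lebesgue_Rn R n).


(** The form in which weights are used: nonnegative everywhere, and with the
    finite mass on balls that alpha > - n provides. *)
Definition regular_weight (alpha : R) (w : n.-tuple R -> R) : Prop :=
  [/\ measurable_fun [set: Rn R n] w, forall x, 0 <= w x,
      {ae mu, forall x, 0 < w x},
      forall (t : R) x, t != 0 -> w (scalev t x) = `|t| `^ alpha * w x &
      forall c r, (mass w (ballv c r) < +oo)%E].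

(** The positive part of a weight keeps its homogeneity and changes it only on a
    null set. *)
Lemma weight_regular (n_gt0 : (0 < n)%N) w : weight w ->
  exists alpha v, regular_weight alpha v /\ {ae mu, forall x, w x = v x}.
Proof.
move=> [alpha alpha_gt w_class]; exists alpha, (fun x => Num.max (w x) 0).
have [mw wae _ whom] := w_class; split; last first.
  by apply: filterS wae => x wx; rewrite max_l// ltW.
split.
- by apply: measurable_maxr; [exact: mw|exact: measurable_cst].
- by move=> x; rewrite le_max lexx orbT.
- by apply: filterS wae => x wx; rewrite lt_max wx.
- by move=> t x t0; rewrite whom// maxr_pMr ?powR_ge0// mulr0.
- exact: (posweight_ball_lty n_gt0 alpha_gt w_class).
Qed.

Lemma mass_ae w v B : measurable_fun [set: Rn R n] w ->
  measurable_fun [set: Rn R n] v -> {ae mu, forall x, w x = v x} ->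
  measurable (B : set (Rn R n)) -> mass w B = mass v B.
Proof.
move=> mw mv wv mB.
rewrite /mass; apply: ae_eq_integral.
- exact: mB.
- by apply/measurable_EFinP; exact: measurable_funTS.
- by apply/measurable_EFinP; exact: measurable_funTS.
- by apply: filterS wv => x ->.
Qed.

Section congruence.
Variables (w v : n.-tuple R -> R) (f g : n.-tuple R -> R[i]).
Hypotheses (mw : measurable_fun [set: Rn R n] w).
Hypotheses (mv : measurable_fun [set: Rn R n] v).
Hypothesis wv : {ae mu, forall x, w x = v x}.
Hypothesis mf : cmeasurable_fun [set: Rn R n] f.
Hypothesis fg : {ae mu, forall x, f x = g x}.

Let mg : cmeasurable_fun [set: Rn R n] g.
Proof.
apply: (complete_cmeasurable (@lebesgue_Rn_complete R n) _ mf).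
by apply: filterS fg => x ->.
Qed.

Let mTS (D : set (Rn R n)) (h : n.-tuple R -> R[i]) :
  cmeasurable_fun [set: Rn R n] h -> cmeasurable_fun D h.
Proof. exact: cmeasurable_funS. Qed.

Lemma weighted_mean_ae B : measurable (B : set (Rn R n)) ->
  weighted_mean w f B = weighted_mean v g B.
Proof.
move=> mB; rewrite /weighted_mean (mass_ae mw mv wv mB); congr (_ * _).
apply: ae_eq_cintegral.
- exact: mB.
- by apply: cmeasurable_funMr; [exact: mTS|exact: measurable_funTS].
- by apply: cmeasurable_funMr; [exact: mTS|exact: measurable_funTS].
- by apply: filterS2 wv fg => x -> ->.
Qed.

Lemma mean_oscillation_ae B : measurable (B : set (Rn R n)) ->
  mean_oscillation w f B = mean_oscillation v g B.
Proof.
move=> mB; rewrite /mean_oscillation (mass_ae mw mv wv mB) (weighted_mean_ae mB).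
apply: (congr1 (fun z => (_ * z)%E)).
have mosc (h : n.-tuple R -> R[i]) (u : n.-tuple R -> R) (k : R[i]) :
    cmeasurable_fun [set: Rn R n] h -> measurable_fun [set: Rn R n] u ->
    measurable_fun (B : set (Rn R n)) (fun x => (Normc.normc (h x - k) * u x)%:E).
  move=> mh mu'; apply/measurable_EFinP; apply: measurable_funM.
    apply: measurable_normc; apply: cmeasurable_funB; first exact: mTS.
    exact: cmeasurable_cst.
  exact: measurable_funTS.
apply: ae_eq_integral; [exact: mB|exact: mosc|exact: mosc|].
by apply: filterS2 wv fg => x -> ->.
Qed.

Lemma bmo_norm_ae : bmo_norm w f = bmo_norm v g.
Proof.
rewrite /bmo_norm; congr ereal_sup; apply/seteqP; split=> _ [c [r [r0 ->]]];
exists c, r; split => //.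
  by rewrite mean_oscillation_ae//; exact: measurable_ballv.
by rewrite mean_oscillation_ae//; exact: measurable_ballv.
Qed.

Lemma bmo_ae : bmo w f -> bmo v g.
Proof.
move=> [_ fi fn]; split; [exact: mg| |by rewrite -bmo_norm_ae].
move=> c r r0; apply: ae_eq_cintegrable (fi c r r0).
- exact: measurable_ballv.
- by apply: cmeasurable_funMr; [exact: mTS|exact: measurable_funTS].
- by apply: filterS2 wv fg => x -> ->.
Qed.

End congruence.

Section dilation.
Variables (alpha : R) (w : n.-tuple R -> R).
Hypothesis w_reg : regular_weight alpha w.
Variable s : R.
Hypothesis s_neq0 : s != 0.

Let mw : measurable_fun [set: Rn R n] w. Proof. by case: w_reg. Qed.
Let w_ge0 x : 0 <= w x. Proof. by case: w_reg. Qed.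

Let k := `|s| `^ (- alpha) * `|s| ^- n.

Let k_gt0 : 0 < k.
Proof. by rewrite mulr_gt0 ?powR_gt0 ?invr_gt0 ?exprn_gt0 ?normr_gt0. Qed.

Let w_scale x : w x = `|s| `^ (- alpha) * w (scalev s x).
Proof.
case: w_reg => _ _ _ -> // _; rewrite mulrA -powRD ?addNr ?powRr0 ?mul1r//.
by rewrite normr_eq0 s_neq0 implybT.
Qed.

Let sc0 : 0 <= `|s| ^- n. Proof. by rewrite invr_ge0 exprn_ge0. Qed.

Let dil (A : set (Rn R n)) (mA : measurable A) := lebesgue_Rn_dilation s_neq0 mA.

(** The Jacobian |s| ^- n and the homogeneity of w combine into one constant k
    that does not depend on D or g. *)
Lemma ge0_integral_weight_dilation (D : set (Rn R n)) (g : n.-tuple R -> R) :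
  measurable D -> measurable_fun D g -> (forall x, 0 <= g x) ->
  (\int[mu]_(x in (scalev s @^-1` D : set (Rn R n))) (g (scalev s x) * w x)%:E =
   k%:E * \int[mu]_(x in D) (g x * w x)%:E)%E.
Proof.
move=> mD mg g0.
have mgw : measurable_fun D (fun x => (g x * w x)%:E).
  by apply/measurable_EFinP; apply: measurable_funM => //; exact: measurable_funTS.
have gw0 x : D x -> (0 <= (g x * w x)%:E)%E by rewrite lee_fin mulr_ge0.
have mD' : measurable (scalev s @^-1` D : set (Rn R n)).
  by rewrite -[X in measurable X]setTI; exact: measurable_scalev_Rn.
have mg' : measurable_fun (scalev s @^-1` D : set (Rn R n))
    (fun x : Rn R n => (g (scalev s x) * w (scalev s x))%:E).
  have := @measurable_comp _ _ _ (Rn R n) (Rn R n) _ D _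
    (scalev s @^-1` D : set (Rn R n)) (scalev s) mD _ mgw.
  apply; first by move=> _ [x Dx <-].
  by apply: measurable_funTS; exact: measurable_scalev_Rn.
rewrite EFinM -muleA -(ge0_integral_change (measurable_scalev_Rn s_neq0) sc0 dil mD mgw gw0).
rewrite -(ge0_integralZl mu mD' mg') ?lee_fin ?powR_ge0//.
- by apply: eq_integral => x _; rewrite -EFinM [in LHS]w_scale mulrCA.
- by move=> x _; rewrite lee_fin mulr_ge0.
Qed.

Lemma cintegral_weight_dilation (D : set (Rn R n)) (f : n.-tuple R -> R[i]) :
  measurable D -> cintegrable mu D (fun x => f x * (w x)%:C) ->
  cintegrable mu (scalev s @^-1` D) (fun x => f (scalev s x) * (w x)%:C) /\
  cintegral mu (scalev s @^-1` D) (fun x => f (scalev s x) * (w x)%:C) =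
  k%:C * cintegral mu D (fun x => f x * (w x)%:C).
Proof.
move=> mD [fr fi].
have msc := measurable_scalev_Rn (n := n) s_neq0.
have mD' : measurable (scalev s @^-1` D : set (Rn R n)).
  by rewrite -[X in measurable X]setTI; exact: msc.
have key (h : n.-tuple R -> R) : mu.-integrable D (fun x => (h x * w x)%:E) ->
    mu.-integrable (scalev s @^-1` D) (fun x => (h (scalev s x) * w x)%:E) /\
    \int[mu]_(x in scalev s @^-1` D) (h (scalev s x) * w x) =
    k * \int[mu]_(x in D) (h x * w x).
  move=> ih.
  have ih' : mu.-integrable (scalev s @^-1` D)
      (EFin \o (fun x => h (scalev s x) * w (scalev s x))).
    exact: (integrable_change msc sc0 dil mD ih).
  have E x : h (scalev s x) * w x =
      `|s| `^ (- alpha) * (h (scalev s x) * w (scalev s x)).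
    by rewrite [in LHS]w_scale mulrCA.
  split.
    under eq_fun do rewrite E.
    by have := integrableZl mD' (`|s| `^ (- alpha)) ih'.
  under eq_Rintegral do rewrite E.
  rewrite (RintegralZl _ mD' ih') /k -mulrA.
  by rewrite -(Rintegral_change msc sc0 dil mD ih).
have fr' : mu.-integrable D (fun x => (complex.Re (f x) * w x)%:E).
  by under eq_fun do rewrite -cReMr.
have fi' : mu.-integrable D (fun x => (complex.Im (f x) * w x)%:E).
  by under eq_fun do rewrite -cImMr.
have [r1 r2] := key _ fr'; have [i1 i2] := key _ fi'.
split.
  by split; [under eq_fun do rewrite cReMr|under eq_fun do rewrite cImMr].
apply: complexP; rewrite ?cReM ?cImM /= mul0r ?subr0 ?addr0.
  under eq_Rintegral do rewrite cReMr; rewrite r2.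
  by congr (_ * _); apply: eq_Rintegral => x _; rewrite cReMr.
under eq_Rintegral do rewrite cImMr; rewrite i2.
by congr (_ * _); apply: eq_Rintegral => x _; rewrite cImMr.
Qed.

Lemma mass_dilation (D : set (Rn R n)) : measurable D ->
  (mass w (scalev s @^-1` D) = k%:E * mass w D)%E.
Proof.
move=> mD; have := @ge0_integral_weight_dilation D (fun=> 1) mD (measurable_cst _).
move=> /(_ (fun=> ler01)); rewrite /mass.
by under eq_integral do rewrite mul1r; under [in RHS]eq_integral do rewrite mul1r.
Qed.

Variable f : n.-tuple R -> R[i].
Hypothesis mf : cmeasurable_fun [set: Rn R n] f.
Variables (c : n.-tuple R) (r : R).
Hypothesis fw : cintegrable mu (ballv (scalev s c) (`|s| * r))
  (fun x => f x * (w x)%:C).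

Let B := ballv (scalev s c) (`|s| * r).

Let BE : ballv c r = scalev s @^-1` B.
Proof. by rewrite preimage_scalev_ballv. Qed.

Let mB : measurable (B : set (Rn R n)).
Proof. exact: measurable_ballv. Qed.

Let fineM_mass : fine (mass w (ballv c r)) = k * fine (mass w B).
Proof.
rewrite BE (mass_dilation mB) fineM// ge0_fin_numE.
  by case: w_reg => _ _ _ _; apply.
by apply: integral_ge0 => x _; rewrite lee_fin.
Qed.

Lemma weighted_mean_dilation :
  weighted_mean w (f \o scalev s) (ballv c r) = weighted_mean w f B.
Proof.
rewrite /weighted_mean fineM_mass BE.
have [_ ->] := cintegral_weight_dilation mB fw.
rewrite mulrA -rmorphM; congr (_%:C * _).
by rewrite invfM mulrAC mulVf ?gt_eqF// mul1r.
Qed.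

(** Mass and weighted integrals acquire the same factor k, which cancels. *)
Lemma mean_oscillation_dilation :
  mean_oscillation w (f \o scalev s) (ballv c r) = mean_oscillation w f B.
Proof.
rewrite /mean_oscillation weighted_mean_dilation fineM_mass BE.
rewrite (@ge0_integral_weight_dilation B (fun x => Normc.normc (f x - weighted_mean w f B)) mB).
- by rewrite muleA -EFinM invfM mulrAC mulVf ?gt_eqF// mul1r.
- apply: measurable_normc; apply: cmeasurable_funB; last exact: cmeasurable_cst.
  exact: cmeasurable_funS mf.
- by move=> x; exact: normc_ge0.
Qed.

End dilation.

End regular_weights.

(** * Weighted means on a ball *)

Section restriction.
Context d (T : measurableType d) (R : realType).
Variable mu : {measure set T -> \bar R}.
Variables (D : set T) (F : T -> R[i]) (u : T -> R).

Lemma cintegral_mkcondr :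
  cintegral mu D (fun x => F x * (u x)%:C) =
  cintegral mu setT (fun x => F x * ((u \_ D) x)%:C).
Proof.
apply: complexP; rewrite /= Rintegral_mkcond; apply: eq_Rintegral => x _;
by rewrite !patchE; case: ifP; rewrite ?(cReMr, cImMr)// mulr0.
Qed.

Lemma cintegrable_mkcondr : measurable D ->
  cintegrable mu D (fun x => F x * (u x)%:C) <->
  cintegrable mu setT (fun x => F x * ((u \_ D) x)%:C).
Proof.
move=> mD.
have E1 : (fun x => (complex.Re (F x * ((u \_ D) x)%:C))%:E) =
    ((fun x => (complex.Re (F x * (u x)%:C))%:E) \_ D)%E.
  by apply/funext => x; rewrite !patchE; case: ifP; rewrite ?cReMr// mulr0.
have E2 : (fun x => (complex.Im (F x * ((u \_ D) x)%:C))%:E) =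
    ((fun x => (complex.Im (F x * (u x)%:C))%:E) \_ D)%E.
  by apply/funext => x; rewrite !patchE; case: ifP; rewrite ?cImMr// mulr0.
by rewrite /cintegrable E1 E2; split=> -[h1 h2]; split;
  apply/(integrable_mkcond _ mD).
Qed.

Lemma integral_mkcondr_mulr (a : T -> R) :
  (\int[mu]_(x in D) (a x * u x)%:E = \int[mu]_x (a x * (u \_ D) x)%:E)%E.
Proof.
rewrite integral_mkcond; apply: eq_integral => x _.
by rewrite !patchE; case: ifP; rewrite ?mulr0.
Qed.

End restriction.

Section centered.
Context (R : realType) (n : nat) (alpha : R) (w : n.-tuple R -> R).
Local Notation mu := (lebesgue_Rn R n).
Hypothesis w_reg : regular_weight alpha w.


Let mw : measurable_fun [set: Rn R n] w. Proof. by case: w_reg. Qed.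
Let w_ge0 x : 0 <= w x. Proof. by case: w_reg. Qed.

Lemma mass_ge0 B : (0 <= mass w B)%E.
Proof. by apply: integral_ge0 => x _; rewrite lee_fin. Qed.

Lemma mean_oscillation_ge0 (f : n.-tuple R -> R[i]) B :
  (0 <= mean_oscillation w f B)%E.
Proof.
apply: mule_ge0; first by rewrite lee_fin invr_ge0 fine_ge0// mass_ge0.
by apply: integral_ge0 => x _; rewrite lee_fin mulr_ge0// normc_ge0.
Qed.

Lemma bmo_norm_ge0 (f : n.-tuple R -> R[i]) : (0 <= bmo_norm w f)%E.
Proof.
apply: (le_trans (mean_oscillation_ge0 f (ballv (zerov R n) 1))).
by apply: ereal_sup_ubound; exists (zerov R n), 1.
Qed.

Lemma mass_fineK c r : ((fine (mass w (ballv c r)))%:E = mass w (ballv c r))%E.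
Proof.
by rewrite fineK// ge0_fin_numE ?mass_ge0//; case: w_reg => _ _ _ _; apply.
Qed.

Lemma integrable_weight c r : mu.-integrable (ballv c r) (EFin \o w).
Proof.
apply/integrableP; split; first by apply/measurable_EFinP; exact: measurable_funTS.
under eq_integral do rewrite gee0_abs ?lee_fin//.
by case: w_reg => _ _ _ _; apply.
Qed.

Lemma cintegral_cst_weight (k : R[i]) c r :
  cintegrable mu (ballv c r) (fun x => k * (w x)%:C) /\
  cintegral mu (ballv c r) (fun x => k * (w x)%:C) =
    k * (fine (mass w (ballv c r)))%:C.
Proof.
split; first exact: (cintegrableZ k (@measurable_ballv R n c r) (integrable_weight c r)).
exact: (cintegralZ k (@measurable_ballv R n c r) (integrable_weight c r)).
Qed.

Lemma mass_gt0_exists B (P : n.-tuple R -> Prop) : (0 < mass w B)%E ->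
  measurable (B : set (Rn R n)) ->
  {ae mu, forall x, B x -> P x} -> exists2 x, B x & P x.
Proof.
move=> mB0 mB aeP; apply: contrapT => nP.
suff E : mass w B = 0%E by rewrite E ltxx in mB0.
have B0 : mu B = 0%E.
  apply: measure_negligible => //; apply: negligibleS aeP => x Bx /= BP.
  by apply: nP; exists x => //; exact: BP.
have mEw : measurable_fun (B : set (Rn R n)) (fun x => (w x)%:E).
  by apply/measurable_EFinP; exact: measurable_funTS.
rewrite /mass (@ge0_negligible_integral _ _ _ mu B B _ mB mB mEw _ B0).
  by rewrite setDv integral_set0.
by move=> x _; rewrite lee_fin.
Qed.

(** A function with vanishing weighted mean is its own deviation from the mean,
    whatever constant is added to it. *)
Lemma mean_oscillation_centered c r (G g : n.-tuple R -> R[i]) (k : R[i]) :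
  let B := ballv c r in (0 < mass w B)%E ->
  cmeasurable_fun [set: Rn R n] G ->
  cintegrable mu B (fun x => G x * (w x)%:C) ->
  cintegral mu B (fun x => G x * (w x)%:C) = 0 ->
  {ae mu, forall x, B x -> g x = G x + k} ->
  [/\ cmeasurable_fun (B : set (Rn R n)) g,
      cintegrable mu B (fun x => g x * (w x)%:C) &
      mean_oscillation w g B = ((fine (mass w B))^-1%:E *
        \int[mu]_(x in B) (Normc.normc (G x) * w x)%:E)%E].
Proof.
move=> B m0 mG iG G0 gG.
have mB : measurable (B : set (Rn R n)) by exact: measurable_ballv.
have mk : cmeasurable_fun (B : set (Rn R n)) (fun x => G x + k).
  case: mG => mr mi; split.
    under eq_fun do rewrite cReD.
    by apply: measurable_funD; [exact: measurable_funTS|exact: measurable_cst].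
  under eq_fun do rewrite cImD.
  by apply: measurable_funD; [exact: measurable_funTS|exact: measurable_cst].
have mg : cmeasurable_fun (B : set (Rn R n)) g.
  apply: (complete_cmeasurable (@lebesgue_Rn_complete R n) _ mk).
  by apply: filterS gG => x /[apply] ->.
have [ik kE] := cintegral_cst_weight k c r.
have iGk := cintegrableD mB iG ik.
have gE : ae_eq mu B (fun x => G x * (w x)%:C + k * (w x)%:C)
    (fun x => g x * (w x)%:C).
  by apply: filterS gG => x /[apply] ->; rewrite mulrDl.
have ig : cintegrable mu B (fun x => g x * (w x)%:C).
  exact: (complete_cintegrable (@lebesgue_Rn_complete R n) mB gE iGk).
have mass0 : fine (mass w B) != 0.
  by apply/eqP => m00; move: m0; rewrite -mass_fineK -/B m00 ltxx.
have meanE : weighted_mean w g B = k.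
  rewrite /weighted_mean.
  rewrite -(complete_cintegral (@lebesgue_Rn_complete R n) mB gE iGk).
  rewrite (cintegralD mB iG ik) G0 kE add0r mulrCA -rmorphM mulVf// rmorph1.
  by rewrite mulr1.
split => //; rewrite /mean_oscillation meanE; apply: (congr1 (fun z => (_ * z)%E)).
apply: ae_eq_integral; first exact: mB.
- apply/measurable_EFinP; apply: measurable_funM; last exact: measurable_funTS.
  by apply: measurable_normc; apply: cmeasurable_funB => //; exact: cmeasurable_cst.
- apply/measurable_EFinP; apply: measurable_funM; last exact: measurable_funTS.
  by apply: measurable_normc; exact: cmeasurable_funS mG.
- by apply: filterS gG => x /[apply] ->; rewrite addrK.
Qed.

End centered.

(** * Averaged deviations of the dilates *)

Section joint_measurability.
Context (R : realType) (n : nat).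
Local Notation mR := (measurableTypeR R).

Lemma measurable_unit_itv : measurable (`[0, 1]%classic : set (R1 R)).
Proof.
by apply: sub_caratheodory; exact: (measurable_itv `[0, 1] : measurable (_ : set mR)).
Qed.

Lemma measurable_dilate (S : R -> R) : measurable_fun [set: R1 R] S ->
  measurable_fun setT
    (fun z : Rn R n * R1 R => scalev (S z.2) z.1 : n.-tuple mR).
Proof.
move=> mS; apply/measurable_fun_tnthP => i.
rewrite (_ : _ \o _ = (fun z : Rn R n * R1 R => S z.2 * tnth z.1 i)).
  apply: measurable_funM; first exact: (measurableT_comp mS measurable_snd).
  apply: (measurableT_comp (f := fun x : Rn R n => tnth x i)); last exact: measurable_fst.
  by apply: measurable_fun_Rn; exact: measurable_tnth.
by apply/funext => z /=; rewrite tnth_scalev.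
Qed.

End joint_measurability.

Section borel_upper_bound.
Context (R : realType) (n : nat) (alpha : R) (w : n.-tuple R -> R).
Local Notation mR := (measurableTypeR R).
Local Notation mu := (lebesgue_Rn R n).
Local Notation nu := (@completed_lebesgue_measure R).
Hypothesis w_reg : regular_weight alpha w.
Variables psi s : R -> R.
Hypothesis psi_meas : measurable_fun (`[0, 1] : set (R1 R)) psi.
Hypothesis psi_ge0 : forall t : R, t \in `[0, 1] -> 0 <= psi t.
Hypothesis s_meas : measurable_fun (`[0, 1] : set (R1 R)) s.
Hypothesis s_neq0 : {ae nu, forall t : R, t \in `[0, 1] -> s t != 0}.
Local Notation U := (`[0%R, 1%R]%classic : set (R1 R)).
Hypothesis psi_int : nu.-integrable U (EFin \o psi).


Let mw : measurable_fun [set: Rn R n] w. Proof. by case: w_reg. Qed.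
Let w_ge0 x : 0 <= w x. Proof. by case: w_reg. Qed.
Let mU : measurable U. Proof. exact: measurable_unit_itv. Qed.

(* extended by 0, s and psi are measurable on the whole line, which makes the
   results on averages over X * T applicable *)
Let S := s \_ U.
Let P := psi \_ U.

Let mS : measurable_fun [set: R1 R] S.
Proof. exact/(measurable_restrictT _ mU). Qed.

Let mP : measurable_fun [set: R1 R] P.
Proof. exact/(measurable_restrictT _ mU). Qed.

Let P_ge0 t : 0 <= P t.
Proof. by rewrite /P patchE; case: ifPn => // /set_mem; exact: psi_ge0. Qed.

Let P_neq0 t : P t != 0 -> t \in `[0, 1].
Proof. by rewrite /P patchE; case: ifPn => [/set_mem//|]; rewrite eqxx. Qed.

Let SE t : t \in `[0, 1] -> S t = s t.
Proof. by move=> t01; rewrite /S patchE mem_set. Qed.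

Variable f : n.-tuple R -> R[i].
Hypothesis mf : cmeasurable_fun [set: n.-tuple mR] f.
Hypothesis f_bmo : bmo w f.
Variables (c : n.-tuple R) (r : R).
Hypothesis r_gt0 : 0 < r.
Local Notation B := (ballv c r : set (Rn R n)).
Hypothesis mass_gt0 : (0 < mass w B)%E.

Let mB : measurable B. Proof. exact: measurable_ballv. Qed.

Let m := fine (mass w B).
Let m_gt0 : 0 < m.
Proof. by rewrite -lte_fin (mass_fineK w_reg). Qed.

Let W := w \_ B.
Let mW : measurable_fun [set: Rn R n] W.
Proof. by apply/(measurable_restrictT _ mB); exact: measurable_funTS. Qed.
Let W_ge0 x : 0 <= W x.
Proof. by rewrite /W patchE; case: ifP. Qed.

Definition dilate_mean (t : R) : R[i] :=
  weighted_mean w (f \o scalev (s t)) (ballv c r).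

Definition dilate_dev (x : n.-tuple R) (t : R) : R[i] :=
  f (scalev (s t) x) - dilate_mean t.

(** An image of f under the operator, normalized by the choice of the constants
    to have weighted mean zero on the ball. *)
Definition dilate_dev_int (x : n.-tuple R) : R[i] :=
  cintegral nu U (fun t => dilate_dev x t * (psi t)%:C).

Let M t := weighted_mean w (f \o scalev (S t)) (ballv c r).
Let h (z : Rn R n * R1 R) : R[i] := f (scalev (S z.2) z.1) - M z.2.

Let mfS : cmeasurable_fun setT (fun z : Rn R n * R1 R => f (scalev (S z.2) z.1)).
Proof.
case: mf => fr fi; split.
  exact: (measurableT_comp fr (measurable_dilate mS)).
exact: (measurableT_comp fi (measurable_dilate mS)).
Qed.

Let mM : cmeasurable_fun [set: R1 R] M.
Proof.
have ME t : M t = (m^-1)%:C * cintegral mu setT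
    (fun x => f (scalev (S t) x) * (W x)%:C).
  by rewrite /M /weighted_mean cintegral_mkcondr.
have mfW : cmeasurable_fun setT (fun z : Rn R n * R1 R =>
    f (scalev (S z.2) z.1) * (W z.1)%:C).
  by apply: cmeasurable_funMr mfS _; exact: (measurableT_comp mW measurable_fst).
case: mfW => fr fi; split.
  under eq_fun do rewrite ME cReM /= mul0r subr0.
  apply: measurable_funM; first exact: measurable_cst.
  exact: (measurable_Rintegral_fstT mu fr).
under eq_fun do rewrite ME cImM /= mul0r addr0.
apply: measurable_funM; first exact: measurable_cst.
exact: (measurable_Rintegral_fstT mu fi).
Qed.

Let mh : cmeasurable_fun setT h.
Proof.
apply: cmeasurable_funB; first exact: mfS.
case: mM => Mr Mi; split.
  exact: (measurableT_comp Mr measurable_snd).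
exact: (measurableT_comp Mi measurable_snd).
Qed.

Let mfRn : cmeasurable_fun [set: Rn R n] f.
Proof. by case: mf => fr fi; split; exact: measurable_fun_Rn. Qed.

Let fw t : S t != 0 -> cintegrable mu (ballv (scalev (S t) c) (`|S t| * r))
  (fun x => f x * (w x)%:C).
Proof.
by move=> t0; case: f_bmo => _ + _; apply; rewrite mulr_gt0// normr_gt0.
Qed.

Let fdw t : S t != 0 ->
  cintegrable mu B (fun x => f (scalev (S t) x) * (w x)%:C).
Proof.
move=> t0; rewrite -(preimage_scalev_ballv c r t0).
exact: (cintegral_weight_dilation w_reg t0 (@measurable_ballv R n _ _) (fw t0)).1.
Qed.

Let norm_fin : bmo_norm w f \is a fin_num.
Proof. by rewrite ge0_fin_numE ?(bmo_norm_ge0 w_reg)//; case: f_bmo. Qed.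

Let K := fine (bmo_norm w f).

Let K_ge0 : 0 <= K.
Proof. exact: fine_ge0 (bmo_norm_ge0 w_reg f). Qed.

Let mK_ge0 : 0 <= m * K.
Proof. by rewrite mulr_ge0// ltW. Qed.

Let aeS : {ae nu, forall t, P t != 0 -> S t != 0}.
Proof.
apply: filterS s_neq0 => t st0 Pt0; have t01 := P_neq0 Pt0.
by rewrite SE//; exact: st0.
Qed.

(* the deviation of the dilate by s t on B has the oscillation of f on the
   dilated ball *)
Let hL : {ae nu, forall t, P t != 0 ->
  (\int[mu]_x (Normc.normc (h (x, t)) * W x)%:E <= (m * K)%:E)%E}.
Proof.
apply: filterS aeS => t St Pt; have {St Pt} t0 := St Pt.
rewrite -(integral_mkcondr_mulr mu B w (fun x => Normc.normc (h (x, t)))).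
have osc_le : (mean_oscillation w (f \o scalev (S t)) (ballv c r) <= K%:E)%E.
  rewrite (mean_oscillation_dilation w_reg t0 mfRn (fw t0)) /K fineK//.
  apply: ereal_sup_ubound; exists (scalev (S t) c), (`|S t| * r); split => //.
  by rewrite mulr_gt0// normr_gt0.
have := lee_wpmul2l (_ : 0 <= m%:E)%E osc_le; rewrite lee_fin => /(_ (ltW m_gt0)).
by rewrite /mean_oscillation muleA -!EFinM mulfV ?gt_eqF// mul1e.
Qed.

Let h0 : {ae nu, forall t, P t != 0 ->
  cintegral mu setT (fun x => h (x, t) * (W x)%:C) = 0}.
Proof.
apply: filterS aeS => t St Pt; have {St Pt} t0 := St Pt.
rewrite -(cintegral_mkcondr mu B (fun x => h (x, t)) w).
have [iM ME] := cintegral_cst_weight w_reg (M t) c r.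
have -> : (fun x => h (x, t) * (w x)%:C) =
    (fun x => f (scalev (S t) x) * (w x)%:C - M t * (w x)%:C).
  by apply/funext => x; rewrite /h /= mulrBl.
rewrite (cintegralB mB (fdw t0) iM) ME -/m /M /weighted_mean -/m.
rewrite mulrAC -rmorphM mulVf ?gt_eqF// rmorph1 mul1r.
by rewrite subrr.
Qed.

Let IP : nu.-integrable setT (EFin \o P).
Proof.
have := (integrable_mkcond (EFin \o (psi : R1 R -> R)) mU).1 psi_int.
by rewrite restrict_EFin.
Qed.

Let G (x : Rn R n) := cintegral nu setT (fun t => h (x, t) * (P t)%:C).

Let devE x t : t \in `[0, 1] -> dilate_dev x t = h (x, t).
Proof. by move=> t01; rewrite /dilate_dev /dilate_mean /h /M /= SE. Qed.

Let GE x : dilate_dev_int x = G x.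
Proof.
rewrite /G -(cintegral_mkcondr nu U (fun t => h (x, t)) psi).
by apply: eq_cintegral => t /set_mem t01; rewrite devE.
Qed.

Lemma ae_cintegrable_dilate_dev : {ae mu, forall x, B x ->
  cintegrable nu U (fun t => dilate_dev x t * (psi t)%:C)}.
Proof.
have aeh := ae_cintegrable_section mW mP W_ge0 P_ge0 mK_ge0 mh IP hL.
have [_ _ w_gt0 _ _] := w_reg; apply: filterS2 w_gt0 aeh => x wx + Bx.
rewrite {1}/W patchE mem_set// gt_eqF// => /(_ isT) ih.
have := (cintegrable_mkcondr nu (fun t => h (x, t)) psi mU).2 ih.
by apply: eq_cintegrable => // t /set_mem t01; rewrite devE.
Qed.

Lemma cmeasurable_dilate_dev_int :
  cmeasurable_fun [set: Rn R n] dilate_dev_int.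
Proof.
rewrite (_ : dilate_dev_int = G); last by apply/funext => x; exact: GE.
exact: (cmeasurable_average nu mP mh).
Qed.

Lemma cintegrable_dilate_dev_int :
  cintegrable mu B (fun x => dilate_dev_int x * (w x)%:C).
Proof.
rewrite (_ : dilate_dev_int = G); last by apply/funext => x; exact: GE.
apply/(cintegrable_mkcondr mu G w mB).
exact: (cintegrable_average mW mP W_ge0 P_ge0 mK_ge0 mh IP hL).
Qed.

Lemma cintegral_dilate_dev_int :
  cintegral mu B (fun x => dilate_dev_int x * (w x)%:C) = 0.
Proof.
rewrite (_ : dilate_dev_int = G); last by apply/funext => x; exact: GE.
rewrite (cintegral_mkcondr mu B G w).
exact: (cintegral_average0 mW mP W_ge0 P_ge0 mK_ge0 mh IP hL h0).
Qed.

(** Minkowski's inequality for integrals: the deviations at parameter t have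
    oscillation at most the seminorm of f, uniformly in t. *)
Lemma integral_dilate_dev_int_le :
  ((fine (mass w B))^-1%:E *
   \int[mu]_(x in B) (Normc.normc (dilate_dev_int x) * w x)%:E <=
   (\int[nu]_(t in U) (psi t)%:E) * bmo_norm w f)%E.
Proof.
rewrite (_ : dilate_dev_int = G); last by apply/funext => x; exact: GE.
rewrite (integral_mkcondr_mulr mu B w (fun x => Normc.normc (G x))).
have le := integral_average_le mW mP W_ge0 P_ge0 mK_ge0 mh IP hL.
apply: (le_trans (lee_wpmul2l (_ : 0 <= m^-1%:E)%E le)).
  by rewrite lee_fin invr_ge0 ltW.
rewrite muleA -EFinM mulrA mulVf ?gt_eqF// mul1r /K fineK// muleC.
rewrite le_eqVlt; apply/orP; left; apply/eqP; apply: (congr1 (fun z => (z * _)%E)).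
rewrite [RHS]integral_mkcond; apply: eq_integral => t _.
by rewrite /P !patchE; case: ifP.
Qed.

End borel_upper_bound.

(** * Images of BMO functions *)

Section upper_bound.
Context (R : realType) (n : nat) (alpha : R) (w : n.-tuple R -> R).
Local Notation mR := (measurableTypeR R).
Local Notation mu := (lebesgue_Rn R n).
Local Notation nu := (@completed_lebesgue_measure R).
Hypothesis w_reg : regular_weight alpha w.
Variables psi s : R -> R.
Hypothesis psi_meas : measurable_fun (`[0, 1] : set (R1 R)) psi.
Hypothesis psi_ge0 : forall t : R, t \in `[0, 1] -> 0 <= psi t.
Hypothesis s_meas : measurable_fun (`[0, 1] : set (R1 R)) s.
Hypothesis s_neq0 : {ae nu, forall t : R, t \in `[0, 1] -> s t != 0}.
Local Notation U := (`[0%R, 1%R]%classic : set (R1 R)).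
Local Notation I := (\int[nu]_(t in U) (psi t)%:E)%E.


Let mw : measurable_fun [set: Rn R n] w. Proof. by case: w_reg. Qed.
Let w_ge0 x : 0 <= w x. Proof. by case: w_reg. Qed.
Let mU : measurable U. Proof. exact: measurable_unit_itv. Qed.

Lemma mass_eq0 B : measurable (B : set (Rn R n)) -> mass w B = 0%E -> mu B = 0%E.
Proof.
move=> mB B0; have [_ _ w_gt0 _ _] := w_reg.
have mEw : measurable_fun (B : set (Rn R n)) (fun x => (w x)%:E).
  by apply/measurable_EFinP; exact: measurable_funTS.
have : (\int[mu]_(x in B) `|(w x)%:E| = 0)%E.
  by under eq_integral do rewrite gee0_abs ?lee_fin//.
move/(ae_eq_integral_abs mu mB mEw) => w0.
apply: measure_negligible; first exact: mB.
have : {ae mu, forall x, ~ B x}.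
  by apply: filterS2 w_gt0 w0 => x wx + Bx => /(_ Bx) [wx0]; rewrite wx0 ltxx in wx.
by apply: negligibleS => x Bx /=; exact.
Qed.

(** Radii start at n + 1 so that the smallest ball contains the cube with
    vertices of coordinates -1 and 1. *)
Definition origin_ball k : set (n.-tuple R) := ballv (zerov R n) (n.+1 + k)%:R.

Lemma measurable_origin_ball k : measurable (origin_ball k : set (Rn R n)).
Proof. exact: measurable_ballv. Qed.

Lemma origin_ball_radius k : 0 < (n.+1 + k)%:R :> R.
Proof. by rewrite ltr0n addSn. Qed.

Lemma subset_origin_ball j k : (j <= k)%N -> origin_ball j `<=` origin_ball k.
Proof.
move=> jk x; rewrite /origin_ball !ballv_zerov /= => /lt_le_trans; apply.
by rewrite ler_nat leq_add2l.
Qed.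

Lemma ballv_sub_origin_ball c r : exists k, ballv c r `<=` origin_ball k.
Proof.
have [M M0 cM] := subset_ballv_zerov c r.
exists (Num.bound M); apply: (subset_trans cM); rewrite /origin_ball !ballv_zerov.
move=> x /= /lt_trans; apply; apply: (lt_le_trans (archi_boundP (ltW M0))).
by rewrite ler_nat leq_addl.
Qed.

Lemma origin_ball_cover x : exists k, origin_ball k x.
Proof.
have [k xk] := ballv_sub_origin_ball x 1; exists k; apply: xk.
rewrite /ballv /= /normv big1 ?sqrtr0// => i _.
by rewrite tnth_mktuple subrr expr0n.
Qed.

Lemma mass_origin_ball_gt0 k : (0 < mass w (origin_ball k))%E.
Proof.
rewrite lt_neqAle (mass_ge0 w_reg) andbT; apply/eqP => /esym m0.
have := mass_eq0 (measurable_origin_ball k) m0.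
have b01 : boxv (fun=> 0 : R) (fun=> 1) `<=` origin_ball k.
  apply: (@subset_trans _ (origin_ball 0)); last exact: subset_origin_ball.
  by rewrite /origin_ball addn0; apply: boxv_sub_ballv => _ //; rewrite lerN10.
have box0 := @lebesgue_Rn_boxv_gt0 R n (fun=> 0) (fun=> 1) (fun=> ltr01).
move=> o0; suff : (lebesgue_Rn R n (boxv (fun=> 0%R) (fun=> 1%R)) <= 0)%E.
  by rewrite leNgt box0.
rewrite -o0; apply: le_measure; rewrite ?inE//.
  by apply: measurable_Rn; exact: measurable_boxv.
exact: measurable_origin_ball.
Qed.

Section borel.
Hypothesis psi_int : nu.-integrable U (EFin \o psi).
Variable f : n.-tuple R -> R[i].
Hypothesis mf : cmeasurable_fun [set: n.-tuple mR] f.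
Hypothesis f_bmo : bmo w f.

Let dev := dilate_dev w s f.
Let devI := dilate_dev_int w psi s f.

(** The two families of subtracted constants differ by a function of t alone,
    which is integrable against psi because both integrals converge at some
    common point of the ball. *)
Lemma image_mod_constant (g : n.-tuple R -> R[i]) (a : R -> R[i]) c r : 0 < r ->
  (0 < mass w (ballv c r))%E ->
  {ae mu, forall x,
    cintegrable nu U (fun t => (f (scalev (s t) x) - a t) * (psi t)%:C) /\
    g x = cintegral nu U (fun t => (f (scalev (s t) x) - a t) * (psi t)%:C)} ->
  exists k, {ae mu, forall x, ballv c r x -> g x = devI c r x + k}.
Proof.
move=> r0 m0 gE.
have mB := @measurable_ballv R n c r.
have aeB := ae_cintegrable_dilate_dev w_reg psi_meas psi_ge0 s_meas s_neq0 psi_int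
  mf f_bmo r0 m0.
have both : {ae mu, forall x, ballv c r x ->
    cintegrable nu U (fun t => dev c r x t * (psi t)%:C) /\
    (cintegrable nu U (fun t => (f (scalev (s t) x) - a t) * (psi t)%:C) /\
    g x = cintegral nu U (fun t => (f (scalev (s t) x) - a t) * (psi t)%:C))}.
  by apply: filterS2 aeB gE => x h1 h2 Bx; split => //; exact: h1.
have [x0 _ [i1 [i2 _]]] := mass_gt0_exists w_reg m0 mB both.
pose b t := (dilate_mean w s f c r t - a t) * (psi t)%:C.
have ib : cintegrable nu U b.
  have := cintegrableB mU i2 i1; apply: eq_cintegrable => //= t _.
  by rewrite /b /dev /dilate_dev -mulrBl; congr (_ * _); ring.
exists (cintegral nu U b); apply: filterS both => x /[apply] -[j1 [j2 ->]].
rewrite /devI /dilate_dev_int -(cintegralD mU j1 ib).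
apply: eq_cintegral => t _.
by rewrite /b /dev /dilate_dev -mulrDl; congr (_ * _); ring.
Qed.

(** On the ball, g is the normalized image up to a constant, and the seminorm
    does not see constants. *)
Lemma image_on_ball (g : n.-tuple R -> R[i]) (a : R -> R[i]) c r : 0 < r ->
  (0 < mass w (ballv c r))%E ->
  {ae mu, forall x,
    cintegrable nu U (fun t => (f (scalev (s t) x) - a t) * (psi t)%:C) /\
    g x = cintegral nu U (fun t => (f (scalev (s t) x) - a t) * (psi t)%:C)} ->
  [/\ cmeasurable_fun (ballv c r : set (Rn R n)) g,
      cintegrable mu (ballv c r) (fun x => g x * (w x)%:C) &
      (mean_oscillation w g (ballv c r) <= I * bmo_norm w f)%E].
Proof.
move=> r0 m0 gE; have [k gk] := image_mod_constant r0 m0 gE.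
have [mg ig ->] := mean_oscillation_centered w_reg m0
  (cmeasurable_dilate_dev_int w_reg psi_meas s_meas mf c r)
  (cintegrable_dilate_dev_int w_reg psi_meas psi_ge0 s_meas s_neq0 psi_int mf f_bmo r0 m0)
  (cintegral_dilate_dev_int w_reg psi_meas psi_ge0 s_meas s_neq0 psi_int mf f_bmo r0 m0) gk.
split => //.
exact: (integral_dilate_dev_int_le w_reg psi_meas psi_ge0 s_meas s_neq0 psi_int mf f_bmo r0 m0).
Qed.

(** Oscillations are estimated on each ball separately; measurability and local
    integrability are read off on the balls around the origin, which exhaust the
    space. *)
Lemma image_bmo (g : n.-tuple R -> R[i]) (a : R -> R[i]) :
  {ae mu, forall x,
    cintegrable nu U (fun t => (f (scalev (s t) x) - a t) * (psi t)%:C) /\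
    g x = cintegral nu U (fun t => (f (scalev (s t) x) - a t) * (psi t)%:C)} ->
  bmo w g /\ (bmo_norm w g <= I * bmo_norm w f)%E.
Proof.
move=> gE.
have I_ge0 : (0 <= I)%E.
  by apply: integral_ge0 => t /= t01; rewrite lee_fin psi_ge0.
have norm_ge0 := bmo_norm_ge0 w_reg f.
have gB k := image_on_ball (origin_ball_radius k) (mass_origin_ball_gt0 k) gE.
have norm_le : (bmo_norm w g <= I * bmo_norm w f)%E.
  apply: ge_ereal_sup => _ [c [r [r0 ->]]].
  have [m0|m0] := leP (mass w (ballv c r)) 0%E.
    have mE : mass w (ballv c r) = 0%E by apply/eqP; rewrite eq_le m0 (mass_ge0 w_reg).
    (* the oscillation on a set of mass zero is 0, since 0^-1 = 0 *)
    by rewrite /mean_oscillation mE /= invr0 mul0e mule_ge0.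
  by have [_ _] := image_on_ball r0 m0 gE.
split; last exact: norm_le.
split.
- have cover : [set: Rn R n] = \bigcup_k origin_ball k.
    by apply/esym/seteqP; split => // x _; have [k xk] := origin_ball_cover x; exists k.
  rewrite cover; split; apply/(measurable_fun_bigcup _ measurable_origin_ball).
    by move=> k; have [[]] := gB k.
  by move=> k; have [[]] := gB k.
- move=> c r r0; have [k ck] := ballv_sub_origin_ball c r.
  have [_ ig _] := gB k.
  exact: cintegrableS (measurable_origin_ball k) (@measurable_ballv R n c r) ck ig.
- apply: le_lt_trans norm_le _.
  have [_ _ foo] := f_bmo; rewrite lte_mul_pinfty// ge0_fin_numE//.
  by have /integrableP[_] := psi_int; under eq_integral => t /set_mem t01 do
    rewrite gee0_abs ?lee_fin ?psi_ge0//.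
Qed.

(** The means on a single ball give convergence on the whole space: means on a
    larger ball differ from them by a function of t that is integrable against
    psi, since both integrals converge at some point of the smaller ball. *)
Lemma ae_cintegrable_dilate_mean :
  {ae mu, forall x, cintegrable nu U
    (fun t => (f (scalev (s t) x) - dilate_mean w s f (zerov R n) (n.+1 + 0)%:R t)
       * (psi t)%:C)}.
Proof.
have aeB k := ae_cintegrable_dilate_dev w_reg psi_meas psi_ge0 s_meas s_neq0 psi_int
  mf f_bmo (origin_ball_radius k) (mass_origin_ball_gt0 k).
have aek k : {ae mu, forall x, origin_ball k x -> cintegrable nu U
    (fun t => dev (zerov R n) (n.+1 + 0)%:R x t * (psi t)%:C)}.
  have both : {ae mu, forall x, origin_ball 0 x ->
      cintegrable nu U (fun t => dev (zerov R n) (n.+1 + 0)%:R x t * (psi t)%:C) /\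
      cintegrable nu U (fun t => dev (zerov R n) (n.+1 + k)%:R x t * (psi t)%:C)}.
    apply: filterS2 (aeB 0) (aeB k) => x h1 h2 Bx; split; first exact: h1.
    by apply: h2; exact: (subset_origin_ball (leq0n k)).
  have [x0 _ [i1 i2]] := mass_gt0_exists w_reg (mass_origin_ball_gt0 0)
    (measurable_origin_ball 0) both.
  apply: filterS (aeB k) => x /[apply] ix.
  have := cintegrableD mU ix (cintegrableB mU i1 i2); apply: eq_cintegrable => //= t _.
  have E (u v p q : R[i]) : (u - q) + ((v - p) - (v - q)) = u - p by ring.
  by rewrite -mulrBl -mulrDl; congr (_ * _); exact: E.
have := ae_foralln aek; apply: filterS => x xk.
by have [k] := origin_ball_cover x; exact: xk.
Qed.

End borel.

End upper_bound.

(** * Borel representatives and the upper bound *)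

Section borel_representative.
Context (R : realType) (n : nat).
Local Notation mR := (measurableTypeR R).
Local Notation mu := (lebesgue_Rn R n).
Local Notation nu := (@completed_lebesgue_measure R).
Local Notation U := (`[0%R, 1%R]%classic : set (R1 R)).


(** A Borel f0 is wanted because f0 (s t x) is then jointly measurable in (x, t),
    the preimage of a Lebesgue set under (x, t) |-> s t x being possibly not
    measurable for the product of the Lebesgue sigma-algebras. *)
Lemma borel_representative (f : n.-tuple R -> R[i]) :
  cmeasurable_fun [set: Rn R n] f ->
  exists (N : set (n.-tuple mR)) (f0 : n.-tuple R -> R[i]),
    [/\ measurable N, mu N = 0%E, cmeasurable_fun [set: n.-tuple mR] f0 &
        forall x, ~ N x -> f x = f0 x].
Proof.
move=> [fr fi]; have sf := @borel_lebesgue_sigma_finite R n.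
have [N1 [mN1 N10 f1]] := completed_measurable_fun_modif sf fr.
have [N2 [mN2 N20 f2]] := completed_measurable_fun_modif sf fi.
have mN : measurable (N1 `|` N2) by exact: measurableU.
exists (N1 `|` N2), (fun x => if x \in N1 `|` N2 then 0 else f x); split.
- exact: mN.
- rewrite lebesgue_RnE//; apply: measure_negligible; first exact: mN.
  by apply: negligibleU; [exists N1|exists N2]; split.
- split.
  + rewrite (_ : (fun x => _) = (fun x : n.-tuple mR =>
        if x \in N1 `|` N2 then 0 else complex.Re (f x))).
      by apply: f1 => // x Nx; left.
    by apply/funext => x; case: ifP.
  + rewrite (_ : (fun x => _) = (fun x : n.-tuple mR =>
        if x \in N1 `|` N2 then 0 else complex.Im (f x))).
      by apply: f2 => // x Nx; right.
    by apply/funext => x; case: ifP.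
- by move=> x Nx; rewrite memNset.
Qed.

(** For fixed t with s t != 0, the set of x with s t x in N is a dilate of N,
    hence null; Tonelli's theorem exchanges the roles of x and t. *)
Lemma ae_dilate_notin (s : R -> R) (N : set (n.-tuple mR)) :
  measurable_fun U s ->
  {ae nu, forall t : R, t \in `[0, 1] -> s t != 0} ->
  measurable N -> mu N = 0%E ->
  {ae mu, forall x, {ae nu, forall t, U t -> ~ N (scalev (s t) x)}}.
Proof.
move=> s_meas s_neq0 mN N0.
have mU : measurable U by exact: measurable_unit_itv.
pose S : R1 R -> R := s \_ U.
have mS : measurable_fun [set: R1 R] S by exact/(measurable_restrictT _ mU).
pose F := fun z : Rn R n * R1 R => (\1_N (scalev (S z.2) z.1) * \1_U z.2 : R)%:E.
have mF : measurable_fun setT F.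
  apply/measurable_EFinP; apply: measurable_funM.
    apply: (measurableT_comp (f := \1_N : n.-tuple mR -> R)); last exact: measurable_dilate.
    exact: measurable_indic.
  apply: (measurableT_comp (f := \1_U : R1 R -> R)); last exact: measurable_snd.
  exact: measurable_indic.
have F0 z : (0 <= F z)%E by rewrite lee_fin mulr_ge0.
have FG : (\int[mu]_x \int[nu]_t F (x, t) = 0)%E.
  rewrite (fubini_tonelli (m1 := mu) (m2 := nu) F mF F0).
  rewrite -[RHS](integral0 nu setT).
  apply: ae_eq_integral; [exact: measurableT| |exact: measurable_cst|].
    exact: (measurable_integral_fstT mu mF).
  apply: filterS s_neq0 => t st _.
  have [t01|t01] := boolP (t \in U); last first.
    apply: integral0_eq => x _; rewrite /F /= !indicE (negbTE t01).
    by rewrite mulr0.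
  have t01' : t \in `[0, 1] by exact: (set_mem t01).
  have St : S t = s t by rewrite /S patchE t01.
  rewrite (eq_integral (fun x : Rn R n => (\1_(scalev (s t) @^-1` N : set (Rn R n)) x)%:E)).
    rewrite integral_indic//; last first.
      rewrite -[X in measurable X]setTI; apply: (measurable_scalev_Rn (st t01')) => //.
      exact: measurable_Rn.
    rewrite setIT; apply: etrans (lebesgue_Rn_dilation (st t01') (measurable_Rn mN)) _.
    by rewrite N0 mule0.
  by move=> x _; rewrite /F /= St !indicE t01 mulr1.
have mFx x : measurable_fun setT (fun t => F (x, t)) by exact: measurable_section_snd.
have mG : measurable_fun setT (fun x => \int[nu]_t F (x, t))%E.
  exact: (measurable_integral_sndT nu mF).
have G0 : (\int[mu]_x `| \int[nu]_t F (x, t) | = 0)%E.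
  by under eq_integral do rewrite gee0_abs ?integral_ge0//.
have := (ae_eq_integral_abs mu measurableT mG).1 G0; apply: filterS => x /(_ I) Gx.
have Gx0 : (\int[nu]_t `|F (x, t)| = 0)%E.
  by under eq_integral do rewrite gee0_abs//.
have := (ae_eq_integral_abs nu measurableT (mFx x)).1 Gx0.
apply: filterS => t /(_ I) /= + Ut Nx.
rewrite /F /S /= !indicE !patchE mem_set// mem_set// mulr1 => -[] /eqP.
by rewrite oner_eq0.
Qed.

End borel_representative.

Section upper_bound_lebesgue.
Context (R : realType) (n : nat) (alpha : R) (w : n.-tuple R -> R).
Local Notation mu := (lebesgue_Rn R n).
Local Notation nu := (@completed_lebesgue_measure R).
Hypothesis w_reg : regular_weight alpha w.
Variables psi s : R -> R.
Hypothesis psi_meas : measurable_fun (`[0, 1] : set (R1 R)) psi.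
Hypothesis psi_ge0 : forall t : R, t \in `[0, 1] -> 0 <= psi t.
Hypothesis s_meas : measurable_fun (`[0, 1] : set (R1 R)) s.
Hypothesis s_neq0 : {ae nu, forall t : R, t \in `[0, 1] -> s t != 0}.
Local Notation U := (`[0%R, 1%R]%classic : set (R1 R)).
Local Notation I := (\int[nu]_(t in U) (psi t)%:E)%E.
Hypothesis I_lty : (I < +oo)%E.


Lemma psi_integrable : nu.-integrable U (EFin \o psi).
Proof.
apply/integrableP; split; first exact/measurable_EFinP.
by under eq_integral => t /set_mem t01 do rewrite gee0_abs ?lee_fin ?psi_ge0//.
Qed.

(** Passing to a Borel representative of f changes the integrands, for almost
    every x, on a null set of parameters only, so f and its representative have
    the same images. *)
Lemma hardy_cesaro_upper_bound : hardy_cesaro_bound psi s w (fine I).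
Proof.
have I_ge0 : (0 <= I)%E.
  by apply: integral_ge0 => t /= t01; rewrite lee_fin psi_ge0.
have IE : (fine I)%:E = I by rewrite fineK// ge0_fin_numE.
split; first exact: fine_ge0.
move=> f f_bmo; have [mf _ _] := f_bmo.
have mU : measurable U by exact: measurable_unit_itv.
have mw : measurable_fun [set: Rn R n] w by case: w_reg.
have nuc := @completed_lebesgue_measure_is_complete R.
have [N [f0 [mN N0 mf0 ff0]]] := borel_representative mf.
have fae : {ae mu, forall x, f x = f0 x}.
  exists N; split; [exact: measurable_Rn|exact: N0|].
  by move=> x /= fx; apply: contrapT => Nx; apply: fx; exact: ff0.
have wae : {ae mu, forall x, w x = w x} by exact: aeW.
have f0_bmo : bmo w f0 := bmo_ae mw mw wae mf fae f_bmo.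
have normE : bmo_norm w f = bmo_norm w f0 := bmo_norm_ae mw mw wae mf fae.
have dil := ae_dilate_notin s_meas s_neq0 mN N0.
have psi_int := psi_integrable.
split; last first.
  move=> g [_ [a ga]]; rewrite normE IE.
  apply: (image_bmo w_reg psi_meas psi_ge0 s_meas s_neq0 psi_int mf0 f0_bmo (a := a)).
  apply: filterS2 dil ga => x Nx [ix gx].
  have E : ae_eq nu U (fun t => (f (scalev (s t) x) - a t) * (psi t)%:C)
      (fun t => (f0 (scalev (s t) x) - a t) * (psi t)%:C).
    by apply: filterS Nx => t Nt Ut; have -> := ff0 _ (Nt Ut).
  split; first exact: (complete_cintegrable nuc mU E ix).
  by rewrite gx; exact: (complete_cintegral nuc mU E ix).
(* the integral of f (s t x) itself is the image if it converges; otherwise any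
   constants that make the integrals converge are admissible *)
have [conv|nconv] := pselect (hardy_cesaro_converges psi s f).
  exists (hardy_cesaro psi s f); split; first by move=> _; exact: aeW.
  exists (fun=> 0); apply: filterS conv => x ix /=.
  have E : (fun t => (f (scalev (s t) x) - 0) * (psi t)%:C) =
      (fun t => f (scalev (s t) x) * (psi t)%:C).
    by apply/funext => t; rewrite subr0.
  by rewrite E; split; [exact: ix|].
pose a := dilate_mean w s f0 (zerov R n) (n.+1 + 0)%:R.
exists (fun x => cintegral nu U (fun t => (f (scalev (s t) x) - a t) * (psi t)%:C)).
split=> [conv|]; first exact: (False_ind _ (nconv conv)).
exists a => /=.
have ia := ae_cintegrable_dilate_mean w_reg psi_meas psi_ge0 s_meas s_neq0 psi_int
  mf0 f0_bmo.
apply: filterS2 dil ia => x Nx ix; split; last by [].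
apply: (complete_cintegrable nuc mU _ ix).
by apply: filterS Nx => t Nt Ut; have -> := ff0 _ (Nt Ut).
Qed.

End upper_bound_lebesgue.

(** * Bounded functions in BMO *)

Section lower_bound.
Context (R : realType) (n : nat) (alpha : R) (w : n.-tuple R -> R).
Local Notation mR := (measurableTypeR R).
Local Notation mu := (lebesgue_Rn R n).
Local Notation nu := (@completed_lebesgue_measure R).
Hypothesis w_reg : regular_weight alpha w.


Let mw : measurable_fun [set: Rn R n] w. Proof. by case: w_reg. Qed.
Let w_ge0 x : 0 <= w x. Proof. by case: w_reg. Qed.

Section bounded.
Variable phi : n.-tuple R -> R.
Hypothesis mphi : measurable_fun [set: n.-tuple mR] phi.
Hypothesis phi_le1 : forall x, `|phi x| <= 1.
Let f x : R[i] := (phi x)%:C.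

Let mf : cmeasurable_fun [set: Rn R n] f.
Proof.
split; first exact: measurable_fun_Rn.
exact: measurable_cst.
Qed.

Let mfw c r : measurable_fun (ballv c r : set (Rn R n))
  (fun x => (Normc.normc (f x * (w x)%:C))%:E).
Proof.
apply/measurable_EFinP; apply: measurable_normc; apply: cmeasurable_funMr.
  exact: cmeasurable_funS mf.
exact: measurable_funTS.
Qed.

Let mEw c r : measurable_fun (ballv c r : set (Rn R n)) (fun x => (w x)%:E).
Proof. by apply/measurable_EFinP; exact: measurable_funTS. Qed.

Let fw_le c r : (\int[mu]_(x in ballv c r) (Normc.normc (f x * (w x)%:C))%:E <=
  mass w (ballv c r))%E.
Proof.
apply: ge0_le_integral.
- exact: measurable_ballv.
- by move=> x _; rewrite lee_fin normc_ge0.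
- exact: mfw.
- exact: mEw.
move=> x _; rewrite lee_fin Normc.normcM !normc_real (ger0_norm (w_ge0 x)).
by rewrite ler_piMl.
Qed.

Let ifw c r : cintegrable mu (ballv c r) (fun x => f x * (w x)%:C).
Proof.
apply/cintegrableP; first exact: measurable_ballv.
split.
  apply: cmeasurable_funMr; first exact: cmeasurable_funS mf.
  exact: measurable_funTS.
apply: le_lt_trans (fw_le c r) _.
by case: w_reg => _ _ _ _; apply.
Qed.

(** The oscillation of a function is at most twice its supremum. *)
Lemma bounded_bmo : bmo w f.
Proof.
split; [exact: mf|by move=> c r _; exact: ifw|].
apply: (@le_lt_trans _ _ 2%:E); last exact: ltry.
apply: ge_ereal_sup => _ [c [r [r0 ->]]].
set B := ballv c r; pose m := fine (mass w B).
have m_ge0 : 0 <= m by rewrite fine_ge0// (mass_ge0 w_reg).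
have mE : m%:E = mass w B by exact: mass_fineK w_reg c r.
have mB : measurable (B : set (Rn R n)) by exact: measurable_ballv.
rewrite /mean_oscillation -/m; have [m0|m0] := eqVneq m 0.
  by rewrite m0 invr0 mul0e lee_fin.
have m_gt0 : 0 < m by rewrite lt_neqAle eq_sym m0.
have kle : Normc.normc (weighted_mean w f B) <= 1.
  rewrite /weighted_mean Normc.normcM normc_real -/m ger0_norm ?invr_ge0//.
  rewrite ler_pdivrMl// mulr1 -lee_fin mE.
  exact: le_trans (normc_cintegral_le mB (ifw c r)) (fw_le c r).
set k := weighted_mean w f B in kle *.
have le2 : (\int[mu]_(x in B) (Normc.normc (f x - k) * w x)%:E <= 2%:E * m%:E)%E.
  have w0 x : B x -> (0 <= (w x)%:E)%E by rewrite lee_fin.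
  have e2 : (0 <= 2%:E :> \bar R)%E by rewrite lee_fin.
  rewrite mE /mass -(ge0_integralZl mu mB (@mEw c r) w0 e2).
  apply: ge0_le_integral.
  - exact: mB.
  - by move=> x _; rewrite lee_fin mulr_ge0// normc_ge0.
  - apply/measurable_EFinP; apply: measurable_funM; last exact: measurable_funTS.
    apply: measurable_normc; apply: cmeasurable_funB; last exact: cmeasurable_cst.
    exact: cmeasurable_funS mf.
  - by apply: measurable_funeM; exact: mEw.
  move=> x _; rewrite -EFinM lee_fin ler_wpM2r//.
  apply: le_trans (le_normcD _ _) _; rewrite normcN -[leRHS]/(1 + 1) lerD//.
  by rewrite normc_real.
apply: (le_trans (lee_wpmul2l (_ : 0 <= m^-1%:E)%E le2)).
  by rewrite lee_fin invr_ge0.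
by rewrite -!EFinM lee_fin mulrCA mulVf// mulr1.
Qed.

End bounded.

(** Means are linear in the function, so the oscillations of f and a f compare
    ball by ball. *)
Lemma bmo_norm_scale (f : n.-tuple R -> R[i]) (a : R) : bmo w f -> a != 0 ->
  (`|a|%:E * bmo_norm w f <= bmo_norm w (fun x => (f x * a%:C)%R))%E.
Proof.
move=> [mf fi _] a0; have a_gt0 : 0 < `|a| by rewrite normr_gt0.
rewrite muleC -lee_pdivlMr//.
apply: ge_ereal_sup => _ [c [r [r0 ->]]]; rewrite lee_pdivlMr// muleC.
apply: (@le_trans _ _ (mean_oscillation w (fun x => f x * a%:C) (ballv c r)));
  last by apply: ereal_sup_ubound; exists c, r.
have mB := @measurable_ballv R n c r.
have kE : weighted_mean w (fun x => f x * a%:C) (ballv c r) =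
    weighted_mean w f (ballv c r) * a%:C.
  rewrite /weighted_mean -mulrA; congr (_ * _).
  have [fr fim] := fi c r r0.
  apply: complexP; rewrite ?cReMr ?cImMr /=.
    rewrite -(RintegralZr a mB fr); apply: eq_Rintegral => x _.
    by rewrite !cReMr mulrAC.
  rewrite -(RintegralZr a mB fim); apply: eq_Rintegral => x _.
  by rewrite !cImMr mulrAC.
rewrite /mean_oscillation kE muleCA; apply: lee_wpmul2l.
  by rewrite lee_fin invr_ge0 fine_ge0// (mass_ge0 w_reg).
set k := weighted_mean w f (ballv c r).
have mfk : measurable_fun (ballv c r : set (Rn R n))
    (fun x => (Normc.normc (f x - k) * w x)%:E).
  apply/measurable_EFinP; apply: measurable_funM; last exact: measurable_funTS.
  apply: measurable_normc; apply: cmeasurable_funB; last exact: cmeasurable_cst.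
  exact: cmeasurable_funS mf.
have fk0 x : ballv c r x -> (0 <= (Normc.normc (f x - k) * w x)%:E)%E.
  by rewrite lee_fin mulr_ge0// normc_ge0.
have ea : (0 <= `|a|%:E)%E by rewrite lee_fin.
rewrite -(ge0_integralZl mu mB mfk fk0 ea).
rewrite le_eqVlt; apply/orP; left; apply/eqP; apply: eq_integral => x _.
by rewrite -mulrBl Normc.normcM normc_real -EFinM; congr EFin; ring.
Qed.

End lower_bound.

(** * Eigenfunctions of dilations *)

Section sign_functions.
Context (R : realType) (n : nat) (alpha : R) (w : n.-tuple R -> R).
Local Notation mR := (measurableTypeR R).
Local Notation mu := (lebesgue_Rn R n).
Local Notation nu := (@completed_lebesgue_measure R).
Hypothesis w_reg : regular_weight alpha w.
Variables psi s : R -> R.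
Hypothesis psi_meas : measurable_fun (`[0, 1] : set (R1 R)) psi.
Hypothesis psi_ge0 : forall t : R, t \in `[0, 1] -> 0 <= psi t.
Hypothesis s_neq0 : {ae nu, forall t : R, t \in `[0, 1] -> s t != 0}.
Local Notation U := (`[0%R, 1%R]%classic : set (R1 R)).
Local Notation I := (\int[nu]_(t in U) (psi t)%:E)%E.


Let mU : measurable U. Proof. exact: measurable_unit_itv. Qed.
Let mw : measurable_fun [set: Rn R n] w. Proof. by case: w_reg. Qed.
Let w_ge0 x : 0 <= w x. Proof. by case: w_reg. Qed.
Let nuc := @completed_lebesgue_measure_is_complete R.

Variables (phi : n.-tuple R -> R) (eps : R -> R).
Hypothesis mphi : measurable_fun [set: n.-tuple mR] phi.
Hypothesis phi_le1 : forall x, `|phi x| <= 1.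
Hypothesis phi_scale : forall r x, r != 0 -> phi (scalev r x) = eps r * phi x.
Hypothesis eps1 : forall r, r != 0 -> `|eps r| = 1.
Variables a1 b1 a2 b2 : 'I_n -> R.
Hypothesis ab1 : forall i, a1 i < b1 i.
Hypothesis ab2 : forall i, a2 i < b2 i.
Hypothesis box1 : boxv a1 b1 `<=` ballv (zerov R n) n.+1%:R.
Hypothesis box2 : boxv a2 b2 `<=` ballv (zerov R n) n.+1%:R.
Hypothesis phi1 : forall x, boxv a1 b1 x -> phi x = 1.
Hypothesis phi2 : forall x, boxv a2 b2 x -> phi x = - 1.

Let f x : R[i] := (phi x)%:C.

Lemma box_exists (a b : 'I_n -> R) (P : n.-tuple R -> Prop) :
  (forall i, a i < b i) -> {ae mu, forall x, P x} -> exists2 x, boxv a b x & P x.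
Proof.
move=> ab aeP; apply: contrapT => nP.
have := @lebesgue_Rn_boxv_gt0 R n a b ab; rewrite (measure_negligible (mu := mu)) ?ltxx//.
  by apply: measurable_Rn; exact: measurable_boxv.
by apply: negligibleS aeP => x bx Px; apply: nP; exists x.
Qed.

(** With seminorm zero, phi would be almost everywhere constant on a ball that
    contains both boxes. *)
Lemma bmo_norm_sign_gt0 : (0 < bmo_norm w f)%E.
Proof.
pose B := ballv (zerov R n) n.+1%:R.
have mB : measurable (B : set (Rn R n)) by exact: measurable_ballv.
rewrite lt_neqAle (bmo_norm_ge0 w_reg) andbT; apply/eqP => /esym f0.
have osc0 : mean_oscillation w f B = 0%E.
  apply/eqP; rewrite eq_le (mean_oscillation_ge0 w_reg) andbT -f0.
  by apply: ereal_sup_ubound; exists (zerov R n), n.+1%:R; split.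
have mass0 : (0 < mass w B)%E.
  have := mass_origin_ball_gt0 w_reg 0; rewrite /origin_ball addn0; exact.
have m_neq0 : (fine (mass w B))^-1 != 0.
  rewrite invr_neq0//; apply/eqP => m0.
  by move: mass0; rewrite -(mass_fineK w_reg) m0 ltxx.
set k := weighted_mean w f B in osc0.
have mfk : measurable_fun (B : set (Rn R n)) (fun x => (Normc.normc (f x - k) * w x)%:E).
  apply/measurable_EFinP; apply: measurable_funM; last exact: measurable_funTS.
  apply: measurable_normc; apply: cmeasurable_funB; last exact: cmeasurable_cst.
  split; first by apply: measurable_funTS; exact: measurable_fun_Rn.
  exact: measurable_cst.
have int0 : (\int[mu]_(x in B) `|(Normc.normc (f x - k) * w x)%:E| = 0)%E.
  under eq_integral do rewrite gee0_abs ?lee_fin ?mulr_ge0 ?normc_ge0//.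
  move/eqP: osc0; rewrite /mean_oscillation -/k mule_eq0 eqe (negbTE m_neq0) /=.
  by move/eqP.
have fk := (ae_eq_integral_abs mu mB mfk).1 int0.
have [_ _ w_gt0 _ _] := w_reg.
have {}fk : {ae mu, forall x, B x -> f x = k}.
  apply: filterS2 w_gt0 fk => x wx + Bx => /(_ Bx) [] /eqP.
  rewrite mulf_eq0 (gt_eqF wx) orbF => /eqP h.
  by apply/eqP; rewrite -subr_eq0; apply/eqP; exact: normc_eq0_eq0.
have [x bx fx] := box_exists ab1 fk.
have [y by_ fy] := box_exists ab2 fk.
have := fx (box1 bx); rewrite -(fy (box2 by_)) /f (phi1 bx) (phi2 by_) => -[] /eqP.
by rewrite -subr_eq0 opprK (_ : 1 + 1 = 2)// pnatr_eq0.
Qed.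

Let bmo_f : bmo w f.
Proof. exact: (bounded_bmo w_reg mphi phi_le1). Qed.

Let fE : {ae nu, forall t, U t -> forall x, f (scalev (s t) x) = (eps (s t) * phi x)%:C}.
Proof.
by apply: filterS s_neq0 => t st Ut x; rewrite /f phi_scale//; exact: st.
Qed.

Let mpsi2 : measurable_fun U (fun t => (2 * psi t)%:E).
Proof. by apply/measurable_EFinP; apply: measurable_funM => //; exact: measurable_cst. Qed.

Let I_ge0 : (0 <= I)%E.
Proof. by apply: integral_ge0 => t t01; rewrite lee_fin psi_ge0. Qed.

(** At x in the first box and y in the second, the difference of the two
    integrands is 2 eps (s t) psi t: the unknown constants cancel, and psi is
    integrable because both integrals converge. *)
Lemma bounded_integral_lty : hardy_cesaro_bounded psi s w -> (I < +oo)%E.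
Proof.
move=> [C [_ /(_ f bmo_f) [[g [_ [a ga]]] _]]].
have [x bx [ix _]] := box_exists ab1 ga.
have [y by_ [iy _]] := box_exists ab2 ga.
have := (cintegrableP _ _ mU).1 (cintegrableB mU ix iy).
move=> [mxy xy_lty].
have E : (\int[nu]_(t in U) (Normc.normc ((f (scalev (s t) x) - a t) * (psi t)%:C -
    (f (scalev (s t) y) - a t) * (psi t)%:C))%:E =
    \int[nu]_(t in U) (2 * psi t)%:E)%E.
  apply: ae_eq_integral; [exact: mU| |exact: mpsi2|].
    by apply/measurable_EFinP; exact: measurable_normc.
  apply: filterS2 s_neq0 fE => t st ft Ut; rewrite -mulrBl.
  rewrite !ft// (phi1 bx) (phi2 by_) opprB addrA subrK mulr1 mulrN1.
  rewrite -rmorphB opprK Normc.normcM !normc_real (ger0_norm (psi_ge0 Ut)).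
  rewrite (_ : eps (s t) + eps (s t) = 2 * eps (s t)); last by ring.
  by rewrite normrM eps1 ?mulr1 ?normr_nat//; exact: st.
rewrite E in xy_lty; apply: le_lt_trans xy_lty.
apply: ge0_le_integral.
- exact: mU.
- by move=> t Ut; rewrite lee_fin psi_ge0.
- exact/measurable_EFinP.
- exact: mpsi2.
- by move=> t Ut; rewrite lee_fin ler_peMl ?psi_ge0// ler1n.
Qed.

(** The image of phi is e I phi; hence I times the seminorm of phi, which is
    positive and finite, is at most C times that seminorm. *)
Lemma bound_ge_integral (e C : R) : `|e| = 1 -> (I < +oo)%E ->
  (forall t, U t -> s t != 0 -> eps (s t) = e) ->
  hardy_cesaro_bound psi s w C -> (I <= C%:E)%E.
Proof.
move=> e1 I_lty epsE [C_ge0 /(_ f bmo_f) [[g fg] HC]].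
have IE : (fine I)%:E = I by rewrite fineK// ge0_fin_numE.
have [I0|I0] := eqVneq (fine I) 0; first by rewrite -IE I0 lee_fin.
have psi_int := psi_integrable psi_meas psi_ge0 I_lty.
have [bmo_g norm_g] := HC g fg.
have fx x : ae_eq nu U (fun t => (e * phi x)%:C * (psi t)%:C)
    (fun t => f (scalev (s t) x) * (psi t)%:C).
  apply: filterS2 s_neq0 fE => t st ft Ut.
  by rewrite ft// epsE//; exact: st.
have ie x := cintegrableZ (e * phi x)%:C mU psi_int.
have conv : hardy_cesaro_converges psi s f.
  apply: aeW => x; exact: (complete_cintegrable nuc mU (fx x) (ie x)).
have gE : {ae mu, forall x, g x = f x * (e * fine I)%:C}.
  case: fg => /(_ conv) + _; apply: filterS => x ->; rewrite /hardy_cesaro.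
  rewrite -(complete_cintegral nuc mU (fx x) (ie x)).
  rewrite (cintegralZ (e * phi x)%:C mU psi_int) /f -!rmorphM.
  by congr (_%:C); rewrite mulrCA mulrA.
have [mg _ _] := bmo_g.
have wae : {ae mu, forall x, w x = w x} by exact: aeW.
have a0 : e * fine I != 0.
  by rewrite mulf_neq0// -normr_eq0 e1 oner_eq0.
have := bmo_norm_scale w_reg bmo_f a0.
rewrite -(bmo_norm_ae mw mw wae mg gE) normrM e1 mul1r ger0_norm ?fine_ge0// IE => h.
have [_ _ foo] := bmo_f.
have nf : bmo_norm w f \is a fin_num by rewrite ge0_fin_numE ?(bmo_norm_ge0 w_reg).
rewrite -(lee_pmul2r nf bmo_norm_sign_gt0).
exact: le_trans h norm_g.
Qed.

End sign_functions.

(** * Operator norm and signs of coordinates *)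

Section weight_change.
Context (R : realType) (n : nat).
Local Notation mu := (lebesgue_Rn R n).

(** BMO and its seminorm do not see a change of the weight on a null set. *)
Lemma hardy_cesaro_bound_ae (psi s : R -> R) (w v : n.-tuple R -> R) (C : R) :
  measurable_fun [set: Rn R n] w -> measurable_fun [set: Rn R n] v ->
  {ae mu, forall x, w x = v x} ->
  hardy_cesaro_bound psi s w C -> hardy_cesaro_bound psi s v C.
Proof.
move=> mw mv wv [C0 HC]; split; first exact: C0.
move=> f f_bmo.
have ff (g : n.-tuple R -> R[i]) : {ae mu, forall x, g x = g x} by exact: aeW.
have vw : {ae mu, forall x, v x = w x}.
  by apply: filterS wv => x ->.
have [mf _ _] := f_bmo.
have f_bmo' := bmo_ae mv mw vw mf (ff f) f_bmo.
have [ex all_] := HC f f_bmo'; split; first exact: ex.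
move=> g /all_ [g_bmo gn]; have [mg _ _] := g_bmo.
split; first exact: (bmo_ae mw mv wv mg (ff g) g_bmo).
rewrite -(bmo_norm_ae mw mv wv mg (ff g)).
rewrite (bmo_norm_ae mv mw vw mf (ff f)); exact: gn.
Qed.

End weight_change.

Section sign_function.
Context (R : realType).
Local Notation mR := (measurableTypeR R).

Lemma normr_sgr_le1 (x : R) : `|Num.sg x| <= 1.
Proof. by rewrite normr_sg; case: (x != 0); rewrite ?ler01. Qed.

Lemma measurable_sgr : measurable_fun [set: mR] (Num.sg : mR -> mR).
Proof.
apply: nondecreasing_measurable; first exact: measurableT.
move=> x y xy; have [y0|y0|y0] := ltgtP y 0.
- by rewrite !ltr0_sg// (le_lt_trans xy).
- by rewrite (gtr0_sg y0) (le_trans (ler_norm _))// normr_sgr_le1.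
- by rewrite y0 sgr0 sgr_le0 -y0.
Qed.

Lemma normr_sgr (x : R) : x != 0 -> `|Num.sg x| = 1.
Proof. by rewrite normr_sg => ->. Qed.

End sign_function.

Section sign_bounds.
Context (R : realType) (n : nat) (w : n.-tuple R -> R).
Hypothesis n_gt0 : (0 < n)%N.
Hypothesis w_weight : weight w.
Local Notation mR := (measurableTypeR R).
Local Notation nu := (@completed_lebesgue_measure R).
Variables psi s : R -> R.
Hypothesis psi_meas : measurable_fun (`[0, 1] : set (R1 R)) psi.
Hypothesis psi_ge0 : forall t : R, t \in `[0, 1] -> 0 <= psi t.
Hypothesis s_meas : measurable_fun (`[0, 1] : set (R1 R)) s.
Hypothesis s_neq0 : {ae nu, forall t : R, t \in `[0, 1] -> s t != 0}.
Local Notation U := (`[0%R, 1%R]%classic : set (R1 R)).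
Local Notation I := (\int[nu]_(t in U) (psi t)%:E)%E.

Let i0 : 'I_n := Ordinal n_gt0.

Lemma hardy_cesaro_bound_integral :
  (I < +oo)%E -> hardy_cesaro_bound psi s w (fine I).
Proof.
move=> I_lty; have [alpha [v [v_reg wv]]] := weight_regular n_gt0 w_weight.
have mw : measurable_fun [set: Rn R n] w by case: w_weight => ? _ [].
have [mv _ _ _ _] := v_reg.
have vw : {ae lebesgue_Rn R n, forall x, v x = w x}.
  by apply: filterS wv => x ->.
apply: (hardy_cesaro_bound_ae mv mw vw).
exact: (hardy_cesaro_upper_bound v_reg psi_meas psi_ge0 s_meas s_neq0 I_lty).
Qed.

Lemma hardy_cesaro_norm_le : (I < +oo)%E -> (hardy_cesaro_norm psi s w <= I)%E.
Proof.
move=> I_lty; have HI := hardy_cesaro_bound_integral I_lty.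
have I_ge0 : (0 <= I)%E.
  by apply: integral_ge0 => t t01; rewrite lee_fin psi_ge0.
have IE : (fine I)%:E = I by rewrite fineK// ge0_fin_numE.
by rewrite -IE; apply: ereal_inf_lbound; exists (fine I).
Qed.

Lemma hardy_cesaro_normE : (I < +oo)%E ->
  (forall C, hardy_cesaro_bound psi s w C -> (I <= C%:E)%E) ->
  hardy_cesaro_norm psi s w = I.
Proof.
move=> I_lty HC; apply/eqP; rewrite eq_le hardy_cesaro_norm_le//=.
by apply: le_ereal_inf_tmp => _ [C /HC IC <-].
Qed.

(** Necessity of the integrability of psi, and the exact norm when phi is an
    eigenfunction, from one sign function. The boxes lie in the cube so that a
    single ball contains both. *)
Lemma sign_lower_bounds (phi : n.-tuple R -> R) (eps : R -> R)
    (a1 b1 a2 b2 : 'I_n -> R) :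
  measurable_fun [set: n.-tuple mR] phi -> (forall x, `|phi x| <= 1) ->
  (forall r x, r != 0 -> phi (scalev r x) = eps r * phi x) ->
  (forall r, r != 0 -> `|eps r| = 1) ->
  (forall i, -1 <= a1 i < b1 i) -> (forall i, b1 i <= 1) ->
  (forall i, -1 <= a2 i < b2 i) -> (forall i, b2 i <= 1) ->
  (forall x, boxv a1 b1 x -> phi x = 1) ->
  (forall x, boxv a2 b2 x -> phi x = - 1) ->
  (hardy_cesaro_bounded psi s w -> (I < +oo)%E) /\
  (forall e, `|e| = 1 -> (I < +oo)%E ->
    (forall t, U t -> s t != 0 -> eps (s t) = e) ->
    hardy_cesaro_norm psi s w = I).
Proof.
move=> mphi phi_le1 phi_scale eps1 ab1 b1_le ab2 b2_le phi1 phi2.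
have [alpha [v [v_reg wv]]] := weight_regular n_gt0 w_weight.
have mw : measurable_fun [set: Rn R n] w by case: w_weight => ? _ [].
have [mv _ _ _ _] := v_reg.
have box1 : boxv a1 b1 `<=` ballv (zerov R n) n.+1%:R.
  by apply: boxv_sub_ballv => // i; have /andP[] := ab1 i.
have box2 : boxv a2 b2 `<=` ballv (zerov R n) n.+1%:R.
  by apply: boxv_sub_ballv => // i; have /andP[] := ab2 i.
have lt1 i : a1 i < b1 i by have /andP[] := ab1 i.
have lt2 i : a2 i < b2 i by have /andP[] := ab2 i.
split.
  move=> [C HC].
  apply: (bounded_integral_lty v_reg psi_meas psi_ge0 s_neq0 mphi phi_le1 phi_scale
    eps1 lt1 lt2 phi1 phi2).
  by exists C; exact: (hardy_cesaro_bound_ae mw mv wv HC).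
move=> e e1 I_lty epsE; apply: (hardy_cesaro_normE I_lty) => C HC.
apply: (bound_ge_integral v_reg psi_meas psi_ge0 s_neq0 mphi phi_le1 phi_scale
  lt1 lt2 box1 box2 phi1 phi2 e1 I_lty epsE).
exact: (hardy_cesaro_bound_ae mw mv wv HC).
Qed.

Lemma integral_sign_le :
  (`|\int[nu]_(t in U) (Num.sg (s t) * psi t)%:E| <= I)%E.
Proof.
have mU : measurable U by exact: measurable_unit_itv.
have msg : measurable_fun U (fun t => Num.sg (s t)).
  exact: (@measurableT_comp _ _ _ _ _ _ (Num.sg : mR -> mR) _ (s : R1 R -> mR)
    (@measurable_sgr R) s_meas).
have mf : measurable_fun U (fun t => (Num.sg (s t) * psi t)%:E).
  by apply/measurable_EFinP; exact: measurable_funM.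
apply: (le_trans (le_abse_integral nu mU mf)); apply: ge0_le_integral.
- exact: mU.
- by [].
- exact: measurableT_comp.
- exact/measurable_EFinP.
- move=> t Ut; rewrite abse_EFin lee_fin normrM (ger0_norm (psi_ge0 Ut)).
  by rewrite ler_piMl ?psi_ge0 ?normr_sgr_le1.
Qed.

Let mcoord i : measurable_fun [set: n.-tuple mR] (fun x => tnth x i : mR).
Proof. exact: measurable_tnth. Qed.

Let posbox : (forall i : 'I_n, -1 <= (0 : R) < 1).
Proof. by move=> i; rewrite lerN10 ltr01. Qed.

(** The sign of a coordinate is multiplied by the sign of the dilation factor. *)
Lemma sign_bounds_coordinate :
  (hardy_cesaro_bounded psi s w -> (I < +oo)%E) /\
  (forall e, `|e| = 1 -> (I < +oo)%E ->
    (forall t, U t -> s t != 0 -> Num.sg (s t) = e) ->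
    hardy_cesaro_norm psi s w = I).
Proof.
apply: (@sign_lower_bounds (fun x => Num.sg (tnth x i0)) Num.sg
  (fun=> 0) (fun=> 1) (fun=> -1) (fun=> 0)).
- exact: (@measurableT_comp _ _ _ _ _ _ (Num.sg : mR -> mR) _
    (fun x : n.-tuple mR => tnth x i0 : mR) (@measurable_sgr R) (mcoord i0)).
- by move=> x; exact: normr_sgr_le1.
- by move=> r x _; rewrite tnth_scalev sgrM.
- exact: normr_sgr.
- exact: posbox.
- by [].
- by move=> i; rewrite lexx ltrN10.
- by move=> i; exact: ler01.
- by move=> x /(_ i0) /andP[x0 _]; rewrite gtr0_sg.
- by move=> x /(_ i0) /andP[_ x0]; rewrite ltr0_sg.
Qed.

(** A dilation by r multiplies the product of two coordinates by r ^+ 2 > 0, so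
    its sign is invariant whatever the sign of r. *)
Lemma sign_bounds_product : (1 < n)%N ->
  (hardy_cesaro_bounded psi s w -> (I < +oo)%E) /\
  ((I < +oo)%E -> hardy_cesaro_norm psi s w = I).
Proof.
move=> n_gt1; pose i1 : 'I_n := Ordinal n_gt1.
have i10 : i1 != i0 by [].
have [H1 H2] : (hardy_cesaro_bounded psi s w -> (I < +oo)%E) /\
  (forall e, `|e| = 1 -> (I < +oo)%E ->
    (forall t, U t -> s t != 0 -> (fun=> 1 : R) (s t) = e) ->
    hardy_cesaro_norm psi s w = I).
  apply: (@sign_lower_bounds (fun x => Num.sg (tnth x i0 * tnth x i1)) (fun=> 1 : R)
    (fun=> 0) (fun=> 1) (fun i => if i == i0 then -1 else 0)
    (fun i => if i == i0 then 0 else 1)).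
  - exact: (@measurableT_comp _ _ _ _ _ _ (Num.sg : mR -> mR) _
      (fun x : n.-tuple mR => tnth x i0 * tnth x i1 : mR) (@measurable_sgr R)
      (measurable_funM (mcoord i0) (mcoord i1))).
  - by move=> x; exact: normr_sgr_le1.
  - move=> r x r0; rewrite !tnth_scalev mulrACA sgrM gtr0_sg ?mul1r//.
    by rewrite -expr2 exprn_even_gt0.
  - by move=> r _; rewrite normr1.
  - exact: posbox.
  - by [].
  - by move=> i; case: ifP => _; rewrite ?lexx ?ltrN10 ?lerN10 ?ltr01.
  - by move=> i; case: ifP => _; rewrite ?ler01.
  - by move=> x bx; have /andP[x0 _] := bx i0; have /andP[x1 _] := bx i1;
      rewrite gtr0_sg// mulr_gt0.
  - move=> x bx; have := bx i0; have := bx i1; rewrite eqxx (negbTE i10).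
    by move=> /andP[x1 _] /andP[_ x0]; rewrite ltr0_sg// nmulr_rlt0.
by split=> // I_lty; apply: (H2 1) => //; rewrite normr1.
Qed.

End sign_bounds.

Theorem theorem2p7 (R : realType) (n : nat) (n_gt0 : (0 < n)%N)
    (w : n.-tuple R -> R) (w_weight : weight w)
    (psi s : R -> R)
    (psi_meas : measurable_fun (`[0, 1] : set (R1 R)) psi)
    (psi_ge0 : forall t : R, t \in `[0, 1] -> 0 <= psi t)
    (s_meas : measurable_fun (`[0, 1] : set (R1 R)) s)
    (s_neq0 : {ae @completed_lebesgue_measure R,
       forall t : R, t \in `[0, 1] -> s t != 0}) :
  let I := (\int[@completed_lebesgue_measure R]_(t in `[0%R, 1%R]) (psi t)%:E)%E in
  let J := (\int[@completed_lebesgue_measure R]_(t in `[0%R, 1%R])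
              (Num.sg (s t) * psi t)%R%:E)%E in
  [/\ ((I < +oo)%E ->
        hardy_cesaro_bounded psi s w /\ (hardy_cesaro_norm psi s w <= I)%E),
      (n = 1%N -> hardy_cesaro_bounded psi s w ->
        (`|J| < +oo)%E /\
        ((forall t : R, t \in `[0, 1] -> 0 <= s t) \/
         (forall t : R, t \in `[0, 1] -> s t <= 0) ->
         hardy_cesaro_norm psi s w = I)) &
      ((1 < n)%N ->
        (hardy_cesaro_bounded psi s w <-> (I < +oo)%E) /\
        hardy_cesaro_norm psi s w = I)].
Proof.
move=> I J.
have bound I_lty := hardy_cesaro_bound_integral n_gt0 w_weight psi_meas psi_ge0
  s_meas s_neq0 I_lty.
have norm_le I_lty := hardy_cesaro_norm_le n_gt0 w_weight psi_meas psi_ge0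
  s_meas s_neq0 I_lty.
split.
- by move=> I_lty; split; [exists (fine I); exact: bound|exact: norm_le].
- move=> _ w_bounded.
  have [I_fin normE] := sign_bounds_coordinate n_gt0 w_weight psi_meas psi_ge0
    s_meas s_neq0.
  have I_lty := I_fin w_bounded.
  split.
    exact: (le_lt_trans (integral_sign_le psi_meas psi_ge0 s_meas) I_lty).
  case=> [s_ge0|s_le0].
  + apply: (normE 1 (normr1 R) I_lty) => t Ut st.
    by rewrite gtr0_sg// lt_neqAle eq_sym st; exact: s_ge0.
  + apply: (normE (- 1) _ I_lty); first by rewrite normrN1.
    by move=> t Ut st; rewrite ltr0_sg// lt_neqAle st; exact: s_le0.
- move=> n_gt1; have [I_fin normE] := sign_bounds_product n_gt0 w_weight psi_meas
    psi_ge0 s_meas s_neq0 n_gt1.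
  have I_bounded : (I < +oo)%E -> hardy_cesaro_bounded psi s w.
    by move=> I_lty; exists (fine I); exact: bound.
  split; first by split; [exact: I_fin|exact: I_bounded].
  have [I_lty|] := boolP (I < +oo)%E; first exact: normE.
  (* no constant bounds the operator, and the infimum over the empty set is +oo *)
  rewrite -leNgt leye_eq => /eqP I_y; rewrite I_y; apply/ereal_inf_pinfty.
  move=> _ [C HC <-]; have I_lty : (I < +oo)%E := I_fin (ex_intro _ C HC).
  by rewrite I_y ltxx in I_lty.
Qed.
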